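(* Let $n>2$ and let $M_t$, $t\in[0,\tfrac{\pi}{d}]$, be an isoparametric foliation on the unit sphere $(S^{n-1}(1),g^{\mathrm{st}})\subset\mathbb{R}^n$ with $d$ principal curvatures. Let $f$ be a positive function on $[0,\tfrac{\pi}{d}]$ and let $F=r\sqrt{2f(t)}$, i.e. $F(0)=0$ and $F(x)=|x|\sqrt{2f(t)}$ for $x\neq 0$ with $x/|x|\in M_t$. Then $F$ is a Minkowski norm on $\mathbb{R}^n$ (i.e. a Minkowski norm induced by $M_t$) if and only if $f$ can be extended to a positive smooth $D_{2d}$-invariant function on $\mathbb{R}/(2\mathbb{Z}\pi)$ which satisfies $$2f(t)\tfrac{\mathrm{d}^2}{\mathrm{d}t^2}f(t)-\left(\tfrac{\mathrm{d}}{\mathrm{d}t}f(t)\right)^2+4f(t)^2>0$$ everywhere. Equivalently: if and only if $f$ can be extended to a function on $\mathbb{R}/(2\mathbb{Z}\pi)$ such that the polar coordinates presentation $\overline{F}=r\sqrt{2f(t)}$ (at the point $(r\cos t,r\sin t)$) defines a $D_{2d}$-invariant Minkowski norm on $\mathbb{R}^2$.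
   Context: $|\cdot|$ is the standard Euclidean norm on $\mathbb{R}^n$ and $g^{\mathrm{st}}$ the standard flat metric (also its restriction to submanifolds). An isoparametric function on a Riemannian manifold $(M,g)$ is a smooth $p:M\to\mathbb{R}$, regular almost everywhere, with $g(\mathrm{grad}\,p,\mathrm{grad}\,p)=a\circ p$ and $\Delta p=b\circ p$ for some one-variable functions $a,b$; the family of its non-empty level sets is called an isoparametric foliation. An isoparametric foliation on $(S^{n-1}(1),g^{\mathrm{st}})$ with $d\in\{1,2,3,4,6\}$ principal curvatures is given by the level sets of an isoparametric function $p:S^{n-1}(1)\to[-1,1]$ which is the restriction of a homogeneous polynomial of degree $d$ on $\mathbb{R}^n$ and has $\pm1$ as its only critical values; each $p^{-1}(s)$, $-1<s<1$, is a closed connected hypersurface with exactly $d$ distinct principal curvatures, and $p^{-1}(\pm1)$ are the two focal submanifolds. It is parametrized as $M_t$, $t\in[0,\tfrac{\pi}d]$, so that $\mathrm{dist}_{S^{n-1}(1)}(x,M_0)=t$ for all $x\in M_t$, where $M_0$ and $M_{\pi/d}$ are the focal submanifolds. A Minkowski norm on $\mathbb{R}^m$ ($m\ge2$) is a continuous function $F:\mathbb{R}^m\to\mathbb{R}_{\ge0}$ which is positive and smooth on $\mathbb{R}^m\setminus\{0\}$, satisfies $F(\lambda x)=\lambda F(x)$ for all $\lambda\ge0$, and for which the Hessian matrix of $E=\tfrac12F^2$ is positive definite at every $x\neq0$. A Minkowski norm on $\mathbb{R}^n$ is induced by $M_t$ if it is constant on each $M_t$. $D_{2d}$ is the finite group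 ($\mathbb{Z}_2$ if $d=1$, dihedral of order $2d$ if $d>1$) of linear isometries of $\mathbb{R}^2$ generated by the reflection $(x_1,x_2)\mapsto(x_1,-x_2)$ and the rotation by angle $\tfrac{2\pi}{d}$; on the polar angle $t\in\mathbb{R}/(2\mathbb{Z}\pi)$ it acts by the group generated by $t\mapsto -t$ and $t\mapsto t+\tfrac{2\pi}{d}$. *)

(* Defs.v *)
(* R^n is 'rV[R]_n for R : realType. The library norm
   `|x| on 'rV[R]_n is the sup norm: it induces the usual topology, but all
   metric notions below use the Euclidean norm [enorm]. *)
From HB Require Import structures.
From mathcomp Require Import all_boot all_order all_algebra.
From mathcomp Require Import all_classical all_reals all_analysis.
(* Imported without its notations, which clash with those of mathcomp-analysis. *)
From mathcomp Require mpoly.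
Import(canonicals, coercions) mpoly.
Import Order.TTheory GRing.Theory Num.Theory.
Import numFieldNormedType.Exports.

Set Implicit Arguments.
Unset Strict Implicit.
Unset Printing Implicit Defensive.

Local Open Scope classical_set_scope.
Local Open Scope ring_scope.

Section Euclidean.
Variables (R : realType) (n : nat).
Implicit Types (x v : 'rV[R]_n).

Definition dotv x v : R := \sum_(i < n) x 0 i * v 0 i.

Definition enorm x : R := Num.sqrt (dotv x x).

Definition ebase (i : 'I_n) : 'rV[R]_n := delta_mx 0 i.

(* Class C^k through iterated partial derivatives; meaningful for open U. *)
Fixpoint Ck_on (k : nat) (U : set 'rV[R]_n) (f : 'rV[R]_n -> R) : Prop :=
  (forall x, U x -> {for x, continuous f}) /\
  match k with
  | 0%N => True
  | k'.+1 => forall i : 'I_n,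
      (forall x, U x -> derivable f x (ebase i)) /\
      Ck_on k' U ('D_(ebase i) f)
  end.

Definition smooth_on (U : set 'rV[R]_n) (f : 'rV[R]_n -> R) : Prop :=
  forall k, Ck_on k U f.

Definition hessian (f : 'rV[R]_n -> R) x : 'M[R]_n :=
  \matrix_(i, j) 'D_(ebase i) ('D_(ebase j) f) x.

Definition posdefmx (A : 'M[R]_n) : Prop :=
  forall v, v != 0 -> 0 < (v *m A *m v^T) 0 0.

Definition minkowski_norm (F : 'rV[R]_n -> R) : Prop :=
  [/\ continuous F /\ (forall x, 0 <= F x),
      (forall x, x != 0 -> 0 < F x),
      smooth_on [set x | x != 0] F,
      (forall (l : R) x, 0 <= l -> F (l *: x) = l * F x) &
      (forall x, x != 0 -> posdefmx (hessian (fun y => F y ^+ 2 / 2) x))].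

End Euclidean.

Arguments ebase {R n} i.

Section Sphere.
Variables (R : realType) (n : nat).
Implicit Types (p : 'rV[R]_n -> R) (X : 'rV[R]_n -> 'rV[R]_n).
Implicit Types (x v : 'rV[R]_n) (A : set 'rV[R]_n).

Definition sphere : set 'rV[R]_n := [set x | enorm x = 1].

(* Functions and vector fields on the sphere are represented by functions on
   'rV[R]_n of which only the values on the sphere matter: before being
   differentiated they are extended, constantly along rays, to the complement
   of the origin. *)
Definition ray_ext (T : Type) (u : 'rV[R]_n -> T) x : T := u ((enorm x)^-1 *: x).

Definition smooth_on_sphere p : Prop := smooth_on [set x | x != 0] (ray_ext p).

(* Riemannian gradient: the ray-constant extension has no radial derivative,
   so this vector is tangent to the sphere and represents dp. *)
Definition sgrad p x : 'rV[R]_n := \row_i 'D_(ebase i) (ray_ext p) x.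

Definition tproj x v : 'rV[R]_n := v - dotv v x *: x.

(* Levi-Civita connection of the round metric: for X and v tangent, the
   tangential part of the Euclidean derivative of X along v. *)
Definition scov X x v : 'rV[R]_n := tproj x ('D_v (ray_ext X) x).

(* Divergence: trace over the tangent space at x of v |-> scov X x v, computed
   as the trace on R^n of the endomorphism v |-> scov X x (tproj x v). *)
Definition sdiv X x : R := \sum_(i < n) scov X x (tproj x (ebase i)) 0 i.

Definition slaplacian p x : R := sdiv (sgrad p) x.

(* Geodesic (great-circle) distance on the unit sphere to the subset A. *)
Definition sdist x A : R := inf [set acos (dotv x y) | y in A].

(* Null for the Riemannian measure of the unit sphere, i.e. for the Hausdorff
   measure of dimension n - 1. *)
Definition sphere_null A : Prop :=
  forall e : R, 0 < e ->
  exists (c : nat -> 'rV[R]_n) (r : nat -> R),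
    [/\ forall k, 0 < r k,
        A `<=` \bigcup_k [set x | enorm (x - c k) < r k] &
        (\sum_(0 <= k <oo) ((r k) ^+ n.-1)%:E <= e%:E)%E].

Definition critical_points p : set 'rV[R]_n :=
  [set x | sphere x /\ sgrad p x = 0].

Definition level p (s : R) : set 'rV[R]_n := [set x | sphere x /\ p x = s].

Definition isoparametric_function p : Prop :=
  [/\ smooth_on_sphere p,
      sphere_null (critical_points p) &
      exists a b : R -> R, forall x, sphere x ->
        dotv (sgrad p x) (sgrad p x) = a (p x) /\ slaplacian p x = b (p x)].

Definition unit_normal p x : 'rV[R]_n := (enorm (sgrad p x))^-1 *: sgrad p x.

(* Eigenvalues of the shape operator v |-> - scov (unit_normal p) x v of the
   level hypersurface of p through the regular point x, acting on the tangent
   space of that hypersurface. *)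
Definition principal_curvatures p x : set R :=
  [set kappa | exists v, [/\ v != 0, dotv v x = 0, dotv v (sgrad p x) = 0 &
                             - scov (unit_normal p) x v = kappa *: v]].

(* The family M is only relevant for parameters t in [0, pi / d]. *)
Definition isoparametric_foliation (d : nat) (M : R -> set 'rV[R]_n) : Prop :=
  d \in [:: 1; 2; 3; 4; 6]%N /\
  exists P : mpoly.mpoly n R,
    let p := fun x => mpoly.meval (fun i => x 0 i) P in
    [/\ P \is mpoly.ishomog1 d mpoly.mdeg,
        isoparametric_function p,
        (forall x, sphere x -> -1 <= p x <= 1),
        p @` critical_points p = [set -1; 1] &
        forall s, -1 < s < 1 ->
          [/\ level p s !=set0, compact (level p s), connected (level p s) &
              forall x, level p s x -> (principal_curvatures p x #= `I_d)%card]] /\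
    [/\ [set M t | t in `[0, pi / d%:R]] = [set level p s | s in p @` sphere],
        (M 0 = level p 1 /\ M (pi / d%:R) = level p (-1)) \/
        (M 0 = level p (-1) /\ M (pi / d%:R) = level p 1) &
        forall t x, 0 <= t <= pi / d%:R -> M t x -> sdist x (M 0) = t].

(* F = r sqrt(2 f(t)). *)
Definition foliation_radial (d : nat) (M : R -> set 'rV[R]_n) (f : R -> R)
    (F : 'rV[R]_n -> R) : Prop :=
  F 0 = 0 /\
  forall x t, x != 0 -> 0 <= t <= pi / d%:R -> M t ((enorm x)^-1 *: x) ->
    F x = enorm x * Num.sqrt (2 * f t).

Definition induced_minkowski_norm (d : nat) (M : R -> set 'rV[R]_n)
    (F : 'rV[R]_n -> R) : Prop :=
  minkowski_norm F /\
  forall t, 0 <= t <= pi / d%:R -> forall x y, M t x -> M t y -> F x = F y.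

End Sphere.

Arguments sphere {R n}.

Section Plane.
Variable R : realType.

Definition vec2 (a b : R) : 'rV[R]_2 := \row_(j < 2) (if j == 0 then a else b).

Definition refl2 (x : 'rV[R]_2) : 'rV[R]_2 := vec2 (x 0 0) (- x 0 1).

Definition rot2 (a : R) (x : 'rV[R]_2) : 'rV[R]_2 :=
  vec2 (cos a * x 0 0 - sin a * x 0 1) (sin a * x 0 0 + cos a * x 0 1).

(* The group D_{2d}. The generators have finite order, so closure under
   composition already yields inverses. *)
Inductive dihedral (d : nat) : ('rV[R]_2 -> 'rV[R]_2) -> Prop :=
| dihedral_id : dihedral d id
| dihedral_refl : dihedral d refl2
| dihedral_rot : dihedral d (rot2 (2 * pi / d%:R))
| dihedral_comp g h : dihedral d g -> dihedral d h -> dihedral d (g \o h).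

(* Its action on the polar angle. The inverse of the translation is its
   conjugate by t |-> - t. *)
Inductive dihedral_angle (d : nat) : (R -> R) -> Prop :=
| dihedral_angle_id : dihedral_angle d id
| dihedral_angle_opp : dihedral_angle d (fun t => - t)
| dihedral_angle_shift : dihedral_angle d (fun t => t + 2 * pi / d%:R)
| dihedral_angle_comp g h :
    dihedral_angle d g -> dihedral_angle d h -> dihedral_angle d (g \o h).

Definition dihedral_invariant (d : nat) (F : 'rV[R]_2 -> R) : Prop :=
  forall g, dihedral d g -> forall x, F (g x) = F x.

Definition dihedral_angle_invariant (d : nat) (f : R -> R) : Prop :=
  forall g, dihedral_angle d g -> forall t, f (g t) = f t.

(* g : R -> R is a function on R / 2 pi Z. *)
Definition circle_fun (g : R -> R) : Prop := forall t, g (t + 2 * pi) = g t.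

Definition smooth1 (g : R -> R) : Prop := forall k t, derivable (derive1n k g) t 1.

Definition extends_on (d : nat) (f g : R -> R) : Prop :=
  forall t, 0 <= t <= pi / d%:R -> g t = f t.

(* F = r sqrt(2 g(t)) in polar coordinates. *)
Definition polar_presentation (g : R -> R) (F : 'rV[R]_2 -> R) : Prop :=
  forall r t, 0 <= r -> F (vec2 (r * cos t) (r * sin t)) = r * Num.sqrt (2 * g t).

End Plane.

(* Main.v *)
Require Import Defs.
From HB Require Import structures.
From mathcomp Require Import all_boot all_order all_algebra.
From mathcomp Require Import all_classical all_reals all_analysis.
From mathcomp Require Import ring lra.
From mathcomp Require mpoly.
Import(canonicals, coercions) mpoly.
Import Order.TTheory GRing.Theory Num.Theory.
Import numFieldNormedType.Exports.
Local Open Scope classical_set_scope.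
Local Open Scope ring_scope.

Set Implicit Arguments.
Unset Strict Implicit.
Unset Printing Implicit Defensive.

(** Write [theta] for the angular distance to the focal set [M 0], and
   [T = pi / d]. The proof runs through a cycle of implications: a Minkowski norm
   [F] restricts to a dihedral norm of a plane, a norm of the plane has a profile
   [g] with the stated inequality, and a profile gives back a Minkowski norm.

   The geometry of the foliation enters through a few facts about [theta]. Along a
   minimal great circle from [M 0] to [M T] the polynomial is a binary form of
   degree [d] in [(cos t, sin t)], bounded by 1 in absolute value, that goes from
   an extreme value to the opposite one over an arc of length [pi / d]. Only
   [cos (d t)], up to sign, does this ([extremal_form]), so after a change of sign
   the polynomial equals [cos (d theta)] on the sphere. A minimal great circle from [M 0] to any
   other point carries a form that agrees with [cos (d t)] on an arc, hence
   everywhere ([form_arc_eq]): it goes on to meet every leaf at the distance that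
   the angles prescribe ([foliation_angle]). Finally [theta] is 1-Lipschitz, being
   a distance.

   On the plane of such a great circle the angle is the distance of the polar
   angle to the multiples of [2 pi / d]. There [F] becomes a dihedral norm of
   the plane, whose energy on the unit circle is the profile [g]. At the
   direction [t] the Hessian of the energy takes on [mu] times the radial vector
   plus the angular one the value [g'' + 2 mu g' + (2 mu^2 + 2) g]; positivity for
   all [mu] is the inequality on [g] ([planar_energy_ineq]).

   Conversely let [g] be a profile. Smoothness of [F] is an issue at the focal
   sets only. By its symmetries [g] is a smooth function of [cos (d t)]: the
   derivative of a function with these symmetries vanishes at the zeros of
   the sine, hence is a smooth multiple of the sine ([sym_smooth_derive_cos]). So
   [F / r] is a smooth function of the polynomial. As for convexity, put
   [G = sqrt (2 g)]; the inequality says [G'' + G > 0]. It gives supporting lines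
   to the planar norm ([support_line]), and it makes the gradient at a direction
   in the chamber [0 <= t <= T] stay in the chamber ([gradient_angle_itv]). Since
   [theta] is 1-Lipschitz, the supporting lines lift to supporting hyperplanes of
   [F] ([support_hyperplane]). By compactness this also applies to the profile
   [g - e] for a small [e > 0], and then the energy of [F] minus
   [e |x|^2] has a convex minorant that touches it at a given point; so its
   Hessian there is nonnegative, and the Hessian of the energy is positive
   definite ([posdef_profile_norm]). *)

(** * Differentiation rules and stable algebras of smooth functions *)

Section DeriveLambda.
Variables (R : realType) (V : normedModType R).
Implicit Types (f g : V -> R) (x v : V).

Lemma is_derive_cstf x v (c : R) : is_derive x v (fun _ => c) 0.
Proof. exact: (is_derive_cst c x v). Qed.

Lemma is_derive_add f g x v a b : is_derive x v f a -> is_derive x v g b ->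
  is_derive x v (fun y => f y + g y) (a + b).
Proof. by move=> fa gb; exact: (is_deriveD fa gb). Qed.

Lemma is_derive_sub f g x v a b : is_derive x v f a -> is_derive x v g b ->
  is_derive x v (fun y => f y - g y) (a - b).
Proof. by move=> fa gb; exact: (is_deriveB fa gb). Qed.

Lemma is_derive_opp f x v a : is_derive x v f a ->
  is_derive x v (fun y => - f y) (- a).
Proof. by move=> fa; exact: (is_deriveN fa). Qed.

Lemma is_derive_mul f g x v a b : is_derive x v f a -> is_derive x v g b ->
  is_derive x v (fun y => f y * g y) (a * g x + f x * b).
Proof.
move=> fa gb; apply: is_derive_eq (is_deriveM fa gb) _.
by rewrite /GRing.scale /= addrC [g x * a]mulrC.
Qed.

Lemma is_derive_exp f n x v a : is_derive x v f a ->
  is_derive x v (fun y => f y ^+ n) (n%:R * f x ^+ n.-1 * a).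
Proof.
move=> fa; have := @is_deriveX _ _ f n x v a fa.
suff -> : f ^+ n = (fun y => f y ^+ n) by [].
by apply/funext => y; rewrite exprfctE.
Qed.

Lemma is_derive_bigsum (I : Type) (r : seq I) (h : I -> V -> R) (dh : I -> R) x v :
  (forall i, is_derive x v (h i) (dh i)) ->
  is_derive x v (fun y => \sum_(i <- r) h i y) (\sum_(i <- r) dh i).
Proof.
move=> hd; elim: r => [|i r IH].
  rewrite big_nil.
  have -> : (fun y => \sum_(i <- [::]) h i y) = (fun _ : V => 0 : R).
    by apply/funext => y; rewrite big_nil.
  exact: is_derive_cstf.
rewrite big_cons.
have -> : (fun y => \sum_(j <- i :: r) h j y)
        = (fun y => h i y + \sum_(j <- r) h j y).
  by apply/funext => y; rewrite big_cons.
exact: is_derive_add.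
Qed.

Lemma is_derive_compV (phi : R -> R) f x v (a b : R) :
  is_derive (f x) 1 phi a -> is_derive x v f b ->
  is_derive x v (fun y => phi (f y)) (a * b).
Proof.
move=> pa fb.
have line (g : V -> R) (c : R) : is_derive x v g c <->
    is_derive (0 : R) 1 (fun h : R => g (h *: v + x)) c.
  have E : (fun h : R => h^-1 *: ((g \o shift x) (h *: v) - g x)) =
      (fun h : R => h^-1 *: (((fun h : R => g (h *: v + x)) \o shift 0) (h *: 1)
        - g (0 *: v + x))).
    by apply/funext => h /=; rewrite addr0 scale0r add0r [h%:A]mulr1.
  by split=> -[ex val]; apply: DeriveDef; move: ex val;
    rewrite /derivable /derive E.
apply/line; apply: (@is_derive1_comp _ phi (fun h : R => f (h *: v + x))).
  by rewrite scale0r add0r.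
exact/line.
Qed.

Lemma is_derive_lineE f x v (t a : R) : is_derive (x + t *: v) v f a ->
  is_derive t 1 (fun s : R => f (x + s *: v)) a.
Proof.
move=> [ex val].
have E : (fun h : R => h^-1 *: (((fun s => f (x + s *: v)) \o shift t) (h *: 1)
           - f (x + t *: v))) =
   (fun h : R => h^-1 *: ((f \o shift (x + t *: v)) (h *: v) - f (x + t *: v))).
  apply/funext => h /=; congr (_ *: (f _ - _)).
  by rewrite [h%:A]mulr1 scalerDl addrC -addrA; congr (_ + _); rewrite addrC.
apply: DeriveDef; first by rewrite /derivable E.
by rewrite /derive E.
Qed.

Lemma is_derive_of_line f x v (a : R) :
  is_derive (0 : R) 1 (fun s : R => f (x + s *: v)) a -> is_derive x v f a.
Proof.
move=> [ex val].
have E : (fun h : R => h^-1 *: (((fun s : R => f (x + s *: v)) \o shift 0) (h *: 1)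
           - f (x + (0 : R) *: v))) =
   (fun h : R => h^-1 *: ((f \o shift x) (h *: v) - f x)).
  apply/funext => h /=; congr (_ *: (f _ - f _)).
    by rewrite [h%:A]mulr1 addr0 addrC.
  by rewrite scale0r addr0.
by apply: DeriveDef; move: ex val; rewrite /derivable /derive E.
Qed.

Lemma is_derive_sqrt_comp f x v b : 0 < f x -> is_derive x v f b ->
  is_derive x v (fun y => Num.sqrt (f y)) ((2 * Num.sqrt (f x))^-1 * b).
Proof. by move=> f0 fb; exact: is_derive_compV (is_derive1_sqrt f0) fb. Qed.

Lemma is_derive_inv f x v b : f x != 0 -> is_derive x v f b ->
  is_derive x v (fun y => (f y)^-1) (- (f x) ^- 2 * b).
Proof.
move=> f0 [ex <-]; apply: DeriveDef; first exact: derivableV.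
by rewrite deriveV.
Qed.

Lemma is_derive_unique f x v a b : is_derive x v f a -> is_derive x v f b -> a = b.
Proof. by move=> [_ <-] [_ <-]. Qed.

Lemma is_derive_ext f g x v a : (forall y, f y = g y) ->
  is_derive x v f a -> is_derive x v g a.
Proof. by move=> /funext ->. Qed.

End DeriveLambda.

Section OneVariable.
Variable R : realType.
Implicit Types (f g u w : R -> R).

Lemma is_derive_cont f (x a : R) : is_derive x 1 f a -> {for x, continuous f}.
Proof.
by move=> [ex _]; exact/differentiable_continuous/derivable1_diffP.
Qed.

Lemma is_derive_mulc (c x : R) : is_derive x 1 (fun t => c * t) c.
Proof.
have := @is_derive_mul R R (fun=> c) id x 1 0 1 (is_derive_cstf _ _ _) (is_derive_id _ _).
by move=> h; apply: is_derive_eq h _; rewrite mul0r mulr1 add0r.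
Qed.

Lemma smooth1_class (K : (R -> R) -> Prop) :
  (forall f, K f -> exists2 f', K f' & forall t : R, is_derive t 1 f (f' t)) ->
  forall f, K f -> smooth1 f.
Proof.
move=> KD f Kf k.
have dK h : K h -> K (derive1 h).
  move=> /KD[h' Kh' hh']; suff -> : derive1 h = h' by [].
  by apply/funext => t; rewrite derive1E; have [_ ->] := hh' t.
have {dK}Kk : K (derive1n k f).
  by elim: k => [|k IH]; [rewrite derive1n0|rewrite derive1nS; exact: dK].
by have [h' _ hh'] := KD _ Kk => t; have [] := hh' t.
Qed.

Lemma smooth1_derive f : smooth1 f -> smooth1 (derive1 f).
Proof. by move=> sf k t; rewrite -derive1Sn; exact: sf. Qed.

Lemma smooth1_is_derive f (t : R) : smooth1 f -> is_derive t 1 f (derive1 f t).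
Proof.
by move=> sf; apply: DeriveDef; [exact: (sf 0%N)|rewrite derive1E].
Qed.

Lemma smooth1_cont f : smooth1 f -> continuous f.
Proof. by move=> sf t; exact: is_derive_cont (smooth1_is_derive t sf). Qed.

End OneVariable.

(** Smoothness is proved by exhibiting an algebra of functions that is stable
   under differentiation: its members then have derivatives of all orders. *)
Inductive alg (R : realType) (V : Type) (B : (V -> R) -> Prop) : (V -> R) -> Prop :=
| alg_base f : B f -> alg B f
| alg_cst c : alg B (fun _ => c)
| alg_add f g : alg B f -> alg B g -> alg B (fun x => f x + g x)
| alg_mul f g : alg B f -> alg B g -> alg B (fun x => f x * g x).

Section Alg.
Variables (R : realType) (V : normedModType R).
Implicit Type B : (V -> R) -> Prop.

Lemma alg_ext B f g : (forall x, f x = g x) -> alg B f -> alg B g.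
Proof. by move=> /funext ->. Qed.

Lemma alg_opp B f : alg B f -> alg B (fun x => - f x).
Proof.
move=> Bf; apply: (@alg_ext B (fun x => -1 * f x)) => [x|].
  by rewrite mulN1r.
by apply: alg_mul => //; exact: alg_cst.
Qed.

Lemma alg_exp B f n : alg B f -> alg B (fun x => f x ^+ n).
Proof.
move=> Bf; elim: n => [|n IH]; first exact: (alg_ext (f := fun=> 1)) (alg_cst _ _).
by apply: (@alg_ext B (fun x => f x * f x ^+ n)) (alg_mul Bf IH) => x; rewrite exprS.
Qed.

Lemma alg_bigsum B (I : Type) (r : seq I) (h : I -> V -> R) :
  (forall i, alg B (h i)) -> alg B (fun x => \sum_(i <- r) h i x).
Proof.
move=> Bh; elim: r => [|i r IH].
  by apply: (@alg_ext B (fun=> 0)) (alg_cst _ _) => x; rewrite big_nil.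
apply: (@alg_ext B (fun x => h i x + \sum_(j <- r) h j x)) => [x|].
  by rewrite big_cons.
exact: alg_add.
Qed.

Lemma alg_derive B (U : set V) (v : V) :
  (forall f, B f -> exists2 f', alg B f' & forall x, U x -> is_derive x v f (f' x)) ->
  forall f, alg B f -> exists2 f', alg B f' & forall x, U x -> is_derive x v f (f' x).
Proof.
move=> BD f; elim=> [g /BD//|c|g h Bg [g' Bg' dg] Bh [h' Bh' dh]
                    |g h Bg [g' Bg' dg] Bh [h' Bh' dh]].
- by exists (fun=> 0); [exact: alg_cst|move=> x _; exact: is_derive_cstf].
- exists (fun x => g' x + h' x); first exact: alg_add.
  by move=> x Ux; apply: is_derive_add; [exact: dg|exact: dh].
- exists (fun x => g' x * h x + g x * h' x).
    by apply: alg_add; exact: alg_mul.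
  by move=> x Ux; apply: is_derive_mul; [exact: dg|exact: dh].
Qed.

Lemma alg_cont B (U : set V) :
  (forall f, B f -> forall x, U x -> {for x, continuous f}) ->
  forall f, alg B f -> forall x, U x -> {for x, continuous f}.
Proof.
move=> BC f; elim=> [g /BC//|c x _|g h _ cg _ ch x Ux|g h _ cg _ ch x Ux].
- exact: cvg_cst.
- by apply: cvgD; [exact: cg|exact: ch].
- by apply: cvgM; [exact: cg|exact: ch].
Qed.

End Alg.

Lemma smooth1_alg (R : realType) (B : (R -> R) -> Prop) :
  (forall f, B f -> exists2 f', alg B f' & forall t : R, is_derive t 1 f (f' t)) ->
  forall f, alg B f -> smooth1 f.
Proof.
move=> BD; apply: smooth1_class => f Bf.
have [|f' Bf' df] := @alg_derive R R B setT 1 _ f Bf.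
  by move=> g /BD[g' Bg' dg]; exists g'.
by exists f' => // t; exact: df.
Qed.

(** The smooth functions generate a stable algebra, whence the closure lemmas
   below. *)
Lemma smooth1_algE (R : realType) (f : R -> R) : alg (@smooth1 R) f -> smooth1 f.
Proof.
apply: smooth1_alg => g sg; exists (derive1 g).
  exact/alg_base/smooth1_derive.
by move=> t; exact: smooth1_is_derive.
Qed.

Section SmoothExamples.
Variable R : realType.
Implicit Types f g : R -> R.

Lemma smooth1_sin : smooth1 (@sin R).
Proof.
pose B : (R -> R) -> Prop := fun f => f = sin \/ f = cos.
apply: (@smooth1_alg R B); last by apply: alg_base; left.
move=> _ [|] ->.
  by exists cos; [apply: alg_base; right|move=> t; exact: is_derive_sin].
exists (fun t => - sin t); last by move=> t; exact: is_derive_cos.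
by apply: alg_opp; apply: alg_base; left.
Qed.

Lemma smooth1_cos : smooth1 (@cos R).
Proof.
apply: (@smooth1_class R (fun f => f = cos \/ f = (fun t => - sin t)
   \/ f = (fun t => - cos t) \/ f = sin)); last by left.
move=> _ [|[|[|]]] ->.
- by exists (fun t => - sin t); [tauto|move=> t; exact: is_derive_cos].
- exists (fun t => - cos t); first by tauto.
  by move=> t; apply: is_derive_opp; exact: is_derive_sin.
- exists sin; first by tauto.
  move=> t; apply: is_derive_eq (is_derive_opp (is_derive_cos t)) _.
  by rewrite opprK.
- by exists cos; [tauto|move=> t; exact: is_derive_sin].
Qed.

Lemma smooth1_add f g : smooth1 f -> smooth1 g -> smooth1 (fun t => f t + g t).
Proof. by move=> sf sg; apply/smooth1_algE/alg_add; exact: alg_base. Qed.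

Lemma smooth1_mul f g : smooth1 f -> smooth1 g -> smooth1 (fun t => f t * g t).
Proof. by move=> sf sg; apply/smooth1_algE/alg_mul; exact: alg_base. Qed.

Lemma smooth1_cst (c : R) : smooth1 (fun=> c).
Proof. exact/smooth1_algE/alg_cst. Qed.

Lemma smooth1_opp f : smooth1 f -> smooth1 (fun t => - f t).
Proof. by move=> sf; apply/smooth1_algE/alg_opp; exact: alg_base. Qed.

Lemma smooth1_scale (c : R) f : smooth1 f -> smooth1 (fun t => f (c * t)).
Proof.
move=> sf.
apply: (@smooth1_alg R (fun h => exists2 f, smooth1 f & h = (fun t => f (c * t)))).
  move=> _ [h sh ->]; exists (fun t => derive1 h (c * t) * c).
    apply: alg_mul; last exact: alg_cst.
    by apply: alg_base; exists (derive1 h); [exact: smooth1_derive|].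
  move=> t; apply: (is_derive_compV (phi := h)).
    exact: smooth1_is_derive.
  exact: is_derive_mulc.
by apply: alg_base; exists f.
Qed.

Lemma smooth1_sqrt f : smooth1 f -> (forall t, 0 < f t) ->
  smooth1 (fun t => Num.sqrt (f t)).
Proof.
move=> sf f0; pose r t := Num.sqrt (f t); pose ri t := (Num.sqrt (f t))^-1.
have r0 t : r t != 0 by rewrite gt_eqF // sqrtr_gt0.
pose B : (R -> R) -> Prop := fun h => [\/ smooth1 h, h = r | h = ri].
have dr (t : R) : is_derive t 1 r (2^-1 * ri t * derive1 f t).
  apply: is_derive_eq (is_derive_sqrt_comp (f0 t) (smooth1_is_derive t sf)) _.
  by rewrite /ri invfM.
apply: (@smooth1_alg R B); last by apply: alg_base; constructor 2.
have Br : alg B r by apply: alg_base; constructor 2.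
have Bri : alg B ri by apply: alg_base; constructor 3.
have Bf : alg B (derive1 f) by apply: alg_base; constructor 1; exact: smooth1_derive.
move=> h [sh|->|->].
- exists (derive1 h); first by apply: alg_base; constructor 1; exact: smooth1_derive.
  by move=> t; exact: smooth1_is_derive.
- by exists (fun t => 2^-1 * ri t * derive1 f t) => //;
    do 2?[apply: alg_mul => //]; exact: alg_cst.
- exists (fun t => - (ri t) ^+ 2 * (2^-1 * ri t * derive1 f t)).
    apply: alg_mul; first by apply: alg_opp; exact: alg_exp.
    by do 2?[apply: alg_mul => //]; exact: alg_cst.
  move=> t; apply: is_derive_eq (is_derive_inv (r0 t) (dr t)) _.
  by rewrite /ri exprVn.
Qed.

End SmoothExamples.

(** * Smooth functions of the cosine *)

Section Division.
Variable R : realType.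
Implicit Types (u w : R -> R).

Lemma derive1_val u (t a : R) : is_derive t 1 u a -> derive1 u t = a.
Proof. by move=> [_ <-]; rewrite derive1E. Qed.

(** By the mean value theorem the difference quotients of [u] at [z] are values
   of [w] near [z]. *)
Lemma is_derive_limit u w (z e : R) : 0 < e -> continuous u ->
  (forall x, x != z -> `|x - z| < e -> is_derive x 1 u (w x)) ->
  {for z, continuous w} -> is_derive z 1 u (w z).
Proof.
move=> e0 cu du cw; apply/is_derive1_caratheodory.
exists (fun x => if x == z then w z else (u x - u z) / (x - z)); split.
- move=> x; case: eqVneq => [->|xz]; first by rewrite !subrr mulr0.
  by rewrite divfK // subr_eq0.
- apply/continuous_withinNx; rewrite eqxx.
  apply/cvgrPdist_lt => eps eps0.
  have /cvgrPdist_lt/(_ _ eps0) := cw.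
  move=> /nbhs_ballP[d /= d0 wd].
  rewrite near_withinE /=; apply/nbhs_ballP.
  exists (Num.min d e) => /=; first by rewrite lt_min d0 e0.
  move=> x; rewrite /ball /= lt_min => /andP[xd xe] xz.
  rewrite (negbTE xz).
  have key a b : a < b -> (z <= a) && (b <= z + e) || (z - e <= a) && (b <= z) ->
      exists2 c, c \in `]a, b[%R & u b - u a = w c * (b - a).
    move=> ab H; apply: MVT => //; last exact: continuous_subspaceT.
    move=> y; rewrite in_itv /= => /andP[ay yb].
    have yz : y != z by lra.
    by apply: du => //; rewrite ltr_norml; apply/andP; split; lra.
  move: xe; rewrite ltr_norml => /andP[xe1 xe2].
  move: (xd); rewrite ltr_norml => /andP[xd1 xd2].
  have [zx|xz'] := ltP z x.
    have [|c] := key z x zx; first by lra.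
    rewrite in_itv /= => /andP[c1 c2] ->.
    rewrite mulfK ?subr_eq0 //; apply: wd.
    by rewrite /ball /= ltr_norml; lra.
  have xz2 : x < z by rewrite lt_neqAle xz.
  have [|c] := key x z xz2; first by lra.
  rewrite in_itv /= => /andP[c1 c2] E.
  have -> : (u x - u z) / (x - z) = w c.
    rewrite -[u x - u z]opprB E -[x - z]opprB mulNr divrN opprK mulfK //.
    by rewrite subr_eq0 gt_eqF.
  by apply: wd; rewrite /ball /= ltr_norml; lra.
- by rewrite eqxx.
Qed.

Lemma sin_near_zero (z x : R) : sin z = 0 -> x != z -> `|x - z| < 1 ->
  sin x != 0 /\ cos x != 0.
Proof.
move=> sz xz; rewrite ltr_norml => /andP[x1 x2].
have cz : cos z != 0 by rewrite -norm_sin_eq1 sz normr0 eq_sym oner_eq0.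
have -> : x = z + (x - z) by rewrite addrC subrK.
rewrite (sinD z) (cosD z) sz !mul0r add0r subr0; split; rewrite mulf_neq0 //.
  have [h|h] := ltP 0 (x - z).
    by rewrite gt_eqF // sin2_gt0 //; lra.
  have h0 : 0 < sin (- (x - z)).
    by rewrite sin2_gt0 //; move: xz; rewrite neq_lt => /orP[]; lra.
  by rewrite -[x - z]opprK sinN oppr_eq0 gt_eqF.
by rewrite gt_eqF // cos_gt0_pihalf //; have := @pihalf_ge1 R; lra.
Qed.

Lemma near_sin_zero (z : R) : sin z = 0 ->
  \forall x \near z^', sin x != 0 /\ cos x != 0.
Proof.
move=> sz; rewrite near_withinE /=; apply/nbhs_ballP; exists 1 => //= x.
by rewrite /ball /= distrC => x1 xz; exact: sin_near_zero sz xz x1.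
Qed.

(** The zeros of the sine are isolated, so continuity determines the values
   there. *)
Lemma eq_of_mul_sin u w : continuous u -> continuous w ->
  (forall t, u t * sin t = w t * sin t) -> forall t, u t = w t.
Proof.
move=> cu cw E t; have [st|st] := eqVneq (sin t) 0; last exact: mulIf st _ _ (E t).
have lu : u x @[x --> t^'] --> u t by apply/continuous_withinNx/cu.
have lw : w x @[x --> t^'] --> w t by apply/continuous_withinNx/cw.
have lu' : u x @[x --> t^'] --> w t.
  apply: cvg_trans lw; apply: near_eq_cvg.
  near=> x; apply/esym/(@mulIf _ (sin x)); last exact: E.
  by have [] : sin x != 0 /\ cos x != 0 by near: x; exact: near_sin_zero.
by apply: (cvg_unique _ lu lu').
Unshelve. all: by end_near. Qed.

(** Order of vanishing at the zeros of the sine, in a recursive form that passes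
   to derivatives. *)
Fixpoint vanish (m : nat) (u : R -> R) : Prop :=
  if m is m'.+1 then
    (forall z, sin z = 0 -> u z = 0) /\ vanish m' (derive1 u)
  else True.

Lemma vanishW m u : vanish m.+1 u -> vanish m u.
Proof. by elim: m u => [//|m IH] u [u0 vu]; split => //; exact: IH. Qed.

Lemma derive1_add_smooth u w : smooth1 u -> smooth1 w ->
  derive1 (fun t => u t + w t) = (fun t => derive1 u t + derive1 w t).
Proof.
move=> su sw; apply/funext => t; apply: derive1_val.
by apply: is_derive_add; exact: smooth1_is_derive.
Qed.

Lemma derive1_mul_smooth u w : smooth1 u -> smooth1 w ->
  derive1 (fun t => u t * w t) = (fun t => derive1 u t * w t + u t * derive1 w t).
Proof.
move=> su sw; apply/funext => t; apply: derive1_val.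
by apply: is_derive_mul; exact: smooth1_is_derive.
Qed.

Lemma vanish_add m u w : smooth1 u -> smooth1 w -> vanish m u -> vanish m w ->
  vanish m (fun t => u t + w t).
Proof.
elim: m u w => [//|m IH] u w su sw [u0 vu] [w0 vw]; split.
  by move=> z sz; rewrite u0 // w0 // addr0.
rewrite (derive1_add_smooth su sw).
exact: IH (smooth1_derive su) (smooth1_derive sw) vu vw.
Qed.

Lemma vanish_mul m u w : smooth1 u -> smooth1 w -> vanish m u ->
  vanish m (fun t => u t * w t).
Proof.
elim: m u w => [//|m IH] u w su sw vu; split.
  by move=> z sz; rewrite (proj1 vu) // mul0r.
have su' := smooth1_derive su; have sw' := smooth1_derive sw.
rewrite (derive1_mul_smooth su sw); apply: vanish_add.
- exact: smooth1_mul su' sw.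
- exact: smooth1_mul su sw'.
- exact: IH su' sw (proj2 vu).
- exact: IH su sw' (vanishW vu).
Qed.

(** The numerator of the derivative of [u / sin ^ m], over [sin ^ m.+1]. *)
Definition quot_deriv (m : nat) u : R -> R :=
  fun t => derive1 u t * sin t + - m%:R * (u t * cos t).

Lemma smooth1_quot_deriv m u : smooth1 u -> smooth1 (quot_deriv m u).
Proof.
move=> su; apply: smooth1_add.
  by apply: smooth1_mul; [exact: smooth1_derive|exact: smooth1_sin].
apply: smooth1_mul; first exact: smooth1_cst.
by apply: smooth1_mul; [exact: su|exact: smooth1_cos].
Qed.

(** The gain of one order comes from the factor [- m], which cancels the leading
   terms at the zeros of the sine. *)
Lemma vanish_quot_deriv m u : smooth1 u -> vanish m u ->
  vanish m.+1 (quot_deriv m u).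
Proof.
elim: m u => [|m IH] u su vu.
  by split => // z sz; rewrite /quot_deriv sz mulr0 oppr0 mul0r addr0.
split.
  by move=> z sz; rewrite /quot_deriv sz mulr0 (proj1 vu) // mul0r mulr0 addr0.
have su' := smooth1_derive su.
have -> : derive1 (quot_deriv m.+1 u) =
    (fun t => quot_deriv m (derive1 u) t + u t * (m.+1%:R * sin t)).
  apply/funext => t; apply: derive1_val.
  apply: is_derive_eq (is_derive_add
    (is_derive_mul (smooth1_is_derive t su') (is_derive_sin t))
    (is_derive_mul (is_derive_cstf t 1 (- m.+1%:R))
      (is_derive_mul (smooth1_is_derive t su) (is_derive_cos t)))) _.
  by rewrite /quot_deriv /= -natr1; ring.
have ss := smooth1_mul (smooth1_cst (c := m.+1%:R)) (@smooth1_sin R).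
apply: vanish_add.
- exact: smooth1_quot_deriv su'.
- exact: smooth1_mul su ss.
- exact: IH su' (proj2 vu).
- exact: vanish_mul su ss vu.
Qed.

(** L'Hospital's rule, by induction on the order. *)
Lemma quot_limit m u (z : R) : smooth1 u -> vanish m u -> sin z = 0 ->
  exists l : R, u x / sin x ^+ m @[x --> z^'] --> l.
Proof.
move=> + + sz; elim: m u => [|m IH] u su vu.
  exists (u z); rewrite (_ : (fun x => _) = u).
    by apply/continuous_withinNx; exact: smooth1_cont.
  by apply/funext => x; rewrite expr0 divr1.
have [l' hl'] := IH _ (smooth1_derive su) (proj2 vu).
have cz : cos z != 0 by rewrite -norm_sin_eq1 sz normr0 eq_sym oner_eq0.
pose l := l' / (m.+1%:R * cos z).
exists l.
(* The rule takes the limit of [df / dg] with [z] included; the values at [z]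
   make this quotient continuous there. *)
pose df x := if x == z then l else derive1 u x.
pose dg x := if x == z then 1 else m.+1%:R * sin x ^+ m * cos x.
apply: (@lhopital R u df (fun x => sin x ^+ m.+1) dg (z - 1) (z + 1) z).
- by rewrite in_itv /=; lra.
- move=> x; rewrite !inE /= => -[_ /eqP xz]; rewrite /df (negbTE xz).
  exact: smooth1_is_derive.
- move=> x; rewrite !inE /= => -[_ /eqP xz]; rewrite /dg (negbTE xz).
  exact: (is_derive_exp m.+1 (is_derive_sin x)).
- by rewrite -[X in _ --> X](proj1 vu _ sz); exact: smooth1_cont.
- have -> : 0 = sin z ^+ m.+1 by rewrite sz expr0n.
  exact: (is_derive_cont (is_derive_exp m.+1 (is_derive_sin z))).
- move=> x; rewrite inE /= => -[+ /eqP xz]; rewrite in_itv /= /dg (negbTE xz).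
  move=> /andP[x1 x2].
  have [|sx cx] := @sin_near_zero z x sz xz; first by rewrite ltr_norml; lra.
  by rewrite !mulf_neq0 ?expf_neq0 ?pnatr_eq0.
- have E : l = df z / dg z by rewrite /df /dg eqxx divr1.
  rewrite [X in _ --> X]E.
  apply/(continuous_withinNx (fun x => df x / dg x) z).
  rewrite -E /l.
  have lc : m.+1%:R * cos x @[x --> z^'] --> m.+1%:R * cos z.
    apply: cvgM; first exact: cvg_cst.
    exact: (continuous_withinNx cos z).1 (@continuous_cos R z).
  have nz : m.+1%:R * cos z != 0 by rewrite mulf_neq0 ?pnatr_eq0.
  apply: cvg_trans (cvgM hl' (cvgV nz lc)); apply: near_eq_cvg.
  rewrite near_withinE; near=> x => xz.
  rewrite /= /df /dg (negbTE xz); rewrite !invfM; ring.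
Unshelve. all: by end_near. Qed.

Lemma near_sin_neq0 (t : R) : sin t != 0 -> \forall x \near t, sin x != 0.
Proof.
move=> st; have h0 : 0 < `|sin t| by rewrite normr_gt0.
have /cvgrPdist_lt/(_ _ h0) := @continuous_sin R t.
by apply: filterS => x; apply: contraTneq => ->; rewrite subr0 ltxx.
Qed.

Lemma quot_exists m u : smooth1 u -> vanish m u ->
  exists2 w : R -> R, continuous w & forall t, w t * sin t ^+ m = u t.
Proof.
move=> su vu.
case: m vu => [|m] vu.
  by exists u; [exact: smooth1_cont|move=> t; rewrite expr0 mulr1].
pose q t := u t / sin t ^+ m.+1.
pose w t := if sin t == 0 then lim (q x @[x --> t^']) else q t.
have wz z : sin z = 0 -> w x @[x --> z^'] --> w z.
  move=> sz; have [l hl] := quot_limit su vu sz.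
  have -> : w z = l by rewrite /w sz eqxx; exact: cvg_lim.
  apply: cvg_trans hl; apply: near_eq_cvg; near=> x.
  have [sx _] : sin x != 0 /\ cos x != 0 by near: x; exact: near_sin_zero.
  by rewrite /w (negbTE sx).
have cw : continuous w.
  move=> t; have [st|st] := eqVneq (sin t) 0.
    by apply/continuous_withinNx; exact: wz.
  have wt : w t = q t by rewrite /w (negbTE st).
  rewrite /continuous_at wt.
  have cq : q x @[x --> t] --> q t.
    apply: cvgM; first exact: smooth1_cont.
    apply: cvgV; first by rewrite expf_neq0.
    exact: (is_derive_cont (is_derive_exp m.+1 (is_derive_sin t))).
  apply: cvg_trans cq; apply: near_eq_cvg; near=> x.
  have sx : sin x != 0 by near: x; exact: near_sin_neq0.
  by rewrite /w (negbTE sx).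
exists w => //.
suff E t : sin t != 0 -> w t * sin t ^+ m.+1 = u t.
  move=> t; have [st|st] := eqVneq (sin t) 0; last exact: E.
  by rewrite st expr0n mulr0 (proj1 vu).
by move=> st; rewrite /w (negbTE st) /q divfK // expf_neq0.
Unshelve. all: by end_near. Qed.

(** The derivative of [u / sin ^ m] is [quot_deriv m u / sin ^ m.+1]: the
   continuous functions that are quotients of a smooth [u] by [sin ^ m], with [u]
   vanishing to order [m], form a class that is stable under differentiation. *)
Lemma smooth1_div_sin u : smooth1 u -> (forall z, sin z = 0 -> u z = 0) ->
  exists2 w : R -> R, smooth1 w & forall t, w t * sin t = u t.
Proof.
move=> su u0.
have [w cw E] := @quot_exists 1 u su (conj u0 I).
exists w; last by move=> t; rewrite -E expr1.
apply: (@smooth1_class R (fun w => exists m u, [/\ smooth1 u, vanish m u,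
    continuous w & forall t, w t * sin t ^+ m = u t])); last by exists 1%N, u.
move=> {su u0 cw E} {}w [m [{}u [su vu cw E]]].
have su1 := smooth1_quot_deriv (m := m) su; have vu1 := vanish_quot_deriv su vu.
have [w1 cw1 E1] := quot_exists su1 vu1.
exists w1; first by exists m.+1, (quot_deriv m u).
have d t : sin t != 0 -> is_derive t 1 w (w1 t).
  move=> st.
  apply: (@near_eq_is_derive _ _ _ (fun x => u x * (sin x ^+ m)^-1)).
    near=> x; rewrite -E mulfK // expf_neq0 //.
    by near: x; exact: near_sin_neq0.
  apply: is_derive_eq (is_derive_mul (smooth1_is_derive t su)
    (is_derive_inv _ (is_derive_exp m (is_derive_sin t)))) _.
    by rewrite expf_neq0.
  apply: (@mulIf _ (sin t ^+ m.+1)); first by rewrite expf_neq0.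
  rewrite E1 /quot_deriv; case: (m) => [|k] /=.
    by rewrite expr0 expr1; field.
  by rewrite -natr1 !exprS; field; rewrite expf_neq0.
move=> t; have [st|st] := eqVneq (sin t) 0; last exact: d.
apply: (@is_derive_limit _ _ t 1); [exact: ltr01|exact: cw| |exact: cw1].
move=> x xt x1; apply: d.
exact: (sin_near_zero st xt x1).1.
Unshelve. all: by end_near. Qed.

Lemma derive1_reflect u (z : R) : smooth1 u -> (forall t, u (2 * z - t) = u t) ->
  forall t, derive1 u (2 * z - t) = - derive1 u t.
Proof.
move=> su uE t.
have d1 : is_derive t 1 u (derive1 u (2 * z - t) * (0 - 1)).
  apply: (@is_derive_ext _ _ (fun x => u (2 * z - x))); first exact: uE.
  apply: is_derive_compV; exact: smooth1_is_derive.
have := is_derive_unique d1 (smooth1_is_derive t su).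
by rewrite sub0r mulrN1 => <-; rewrite opprK.
Qed.

(** Invariance under the reflections fixing a zero of the sine, that is, under
   the group generated by [t |-> - t] and [t |-> t + 2 pi]. *)
Definition sym_smooth (G : R -> R) : Prop :=
  smooth1 G /\ forall z, sin z = 0 -> forall t, G (2 * z - t) = G t.

(** The derivative of [G] is odd about each zero of the sine, hence divisible by
   the sine. Minus the quotient is the derivative [w] of [G] with respect to
   [cos t]; as it has the symmetries of [G], the step can be iterated. *)
Lemma sym_smooth_derive_cos G : sym_smooth G ->
  exists2 w : R -> R, sym_smooth w & forall t : R, is_derive t 1 G (w t * - sin t).
Proof.
move=> [sG GE].
have odd (z t : R) : sin z = 0 -> derive1 G (2 * z - t) = - derive1 G t.
  by move=> sz; apply: derive1_reflect => //; exact: GE.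
have [|w sw wE] := smooth1_div_sin (smooth1_opp (smooth1_derive sG)).
  move=> z sz; have := odd z z sz.
  have -> : 2 * z - z = z by lra.
  lra.
exists w; last first.
  by move=> t; rewrite mulrN wE opprK; exact: smooth1_is_derive.
split => // z sz.
apply: eq_of_mul_sin; [|exact: smooth1_cont|].
  move=> t; apply: (@continuous_comp _ _ _ (fun x => 2 * z - x) w).
    apply: cvgB; first exact: cvg_cst.
    exact: cvg_id.
  exact: smooth1_cont.
move=> t.
have s2 : sin (2 * z - t) = - sin t.
  have -> : 2 * z = z + z by ring.
  have := cos2Dsin2 z; rewrite sinB sinD cosD !sz => c2.
  have {}c2 : cos z * cos z = 1 by lra.
  by rewrite c2; ring.
have := wE (2 * z - t); rewrite s2 odd // wE; lra.
Qed.

End Division.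

(** * Smooth functions of several variables *)

Lemma near_eq_continuous (T : topologicalType) (U : topologicalType) (f g : T -> U) (x : T) :
  (\near x, f x = g x) -> {for x, continuous f} -> {for x, continuous g}.
Proof.
move=> fg cf; have fgx := nbhs_singleton fg.
rewrite /prop_for /continuous_at -fgx; apply: cvg_trans cf.
exact: near_eq_cvg fg.
Qed.

Section SmoothOn.
Variables (R : realType) (n : nat).
Implicit Types (f g : 'rV[R]_n -> R) (U : set 'rV[R]_n).

Lemma Ck_on_eq k U f g : open U -> (forall x, U x -> f x = g x) ->
  Ck_on k U f -> Ck_on k U g.
Proof.
move=> oU.
have near_eq (f1 g1 : 'rV[R]_n -> R) x : (forall x, U x -> f1 x = g1 x) ->
    U x -> \near x, f1 x = g1 x.
  move=> fg Ux; near=> y; apply: fg; near: y; exact: open_nbhs_nbhs.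
elim: k f g => [|k IH] f g fg [cf Df]; split => //.
- by move=> x Ux; exact: near_eq_continuous (near_eq _ _ _ fg Ux) (cf x Ux).
- by move=> x Ux; exact: near_eq_continuous (near_eq _ _ _ fg Ux) (cf x Ux).
move=> i; have [df Cf] := Df i; split.
  by move=> x Ux; exact: near_eq_derivable (near_eq _ _ _ fg Ux) (df x Ux).
by apply: IH Cf => x Ux; exact: near_eq_derive (near_eq _ _ _ fg Ux).
Unshelve. all: by end_near. Qed.

Lemma smooth_on_eq U f g : open U -> (forall x, U x -> f x = g x) ->
  smooth_on U f -> smooth_on U g.
Proof. by move=> oU fg sf k; exact: Ck_on_eq oU fg (sf k). Qed.

Lemma smooth_on_class U (K : ('rV[R]_n -> R) -> Prop) : open U ->
  (forall f, K f -> forall x, U x -> {for x, continuous f}) ->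
  (forall f, K f -> forall i, exists2 f', K f' &
     forall x, U x -> is_derive x (ebase i) f (f' x)) ->
  forall f, K f -> smooth_on U f.
Proof.
move=> oU KC KD f Kf k; elim: k f Kf => [|k IH] f Kf; first by split => //; exact: KC.
split; first exact: KC.
move=> i; have [f' Kf' df] := KD f Kf i; split.
  by move=> x /df[].
by apply: Ck_on_eq (IH _ Kf') => // x /df[_ ->].
Qed.

Lemma smooth_on_alg U (B : ('rV[R]_n -> R) -> Prop) : open U ->
  (forall f, B f -> forall x, U x -> {for x, continuous f}) ->
  (forall f, B f -> forall i, exists2 f', alg B f' &
     forall x, U x -> is_derive x (ebase i) f (f' x)) ->
  forall f, alg B f -> smooth_on U f.
Proof.
move=> oU BC BD; apply: smooth_on_class => // f Bf.
  exact: alg_cont BC _ Bf.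
by move=> i; apply: alg_derive Bf => g Bg; exact: BD.
Qed.

Lemma smooth_on_cont U f x : smooth_on U f -> U x -> {for x, continuous f}.
Proof. by move=> sf; have [cf _] := sf 0%N; exact: cf. Qed.

Lemma smooth_on_partial U f i : smooth_on U f -> smooth_on U ('D_(ebase i) f).
Proof. by move=> sf k; have [_ /(_ i)[]] := sf k.+1. Qed.

Lemma smooth_on_is_derive U f i x : smooth_on U f -> U x ->
  is_derive x (ebase i) f ('D_(ebase i) f x).
Proof.
by move=> sf Ux; apply: derivableP; have [_ /(_ i)[+ _]] := sf 1%N; apply.
Qed.

Lemma smooth_on_algE U f : open U -> alg (smooth_on U) f -> smooth_on U f.
Proof.
move=> oU; apply: smooth_on_alg => // g sg.
  by move=> x; exact: smooth_on_cont.
move=> i; exists ('D_(ebase i) g); first exact/alg_base/smooth_on_partial.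
by move=> x; exact: smooth_on_is_derive.
Qed.

Lemma is_derive_coord (x v : 'rV[R]_n) j :
  is_derive x v (fun y : 'rV[R]_n => y 0 j) (v 0 j).
Proof.
have d : derivable (@id 'rV[R]_n) x v by exact: derivable_id.
apply: DeriveDef; first exact: (derivable_mxP _ _ _).1 d 0 j.
by have := derive_mx d; rewrite derive_id => /matrixP/(_ 0 j); rewrite !mxE => <-.
Qed.

End SmoothOn.

Section ChainRule.
Variables (R : realType) (n : nat).
Implicit Types (f : 'rV[R]_n -> R) (U : set 'rV[R]_n).

Lemma MVT_error (phi dphi : R -> R) (a c e : R) :
  (forall s : R, `|s| <= `|a| -> is_derive s 1 phi (dphi s)) ->
  (forall s, `|s| <= `|a| -> `|dphi s - c| <= e) ->
  `|phi a - phi 0 - c * a| <= e * `|a|.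
Proof.
move=> dp de.
have key (x y : R) : x < y -> `|x| <= `|a| -> `|y| <= `|a| ->
    exists2 s, `|s| <= `|a| & phi y - phi x = dphi s * (y - x).
  move=> xy xa ya.
  have inside s : x <= s <= y -> `|s| <= `|a|.
    move: xa ya; rewrite !ler_norml => /andP[? ?] /andP[? ?] /andP[? ?].
    by apply/andP; split; lra.
  have [||s sxy ->] := @MVT _ phi dphi x y xy.
  - by move=> s; rewrite in_itv /= => /andP[? ?]; apply/dp/inside; lra.
  - apply: continuous_in_subspaceT => s; rewrite inE /= in_itv /= => /inside /dp.
    exact: is_derive_cont.
  exists s => //; apply: inside; move: sxy; rewrite in_itv /= => /andP[? ?]; lra.
have [a0|a0|->] := ltgtP a 0.
- have [||s sa E] := key a 0 a0; rewrite ?normr0 //.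
  have -> : phi a - phi 0 - c * a = (dphi s - c) * a by lra.
  by rewrite normrM ler_wpM2r // de.
- have [||s sa E] := key 0 a a0; rewrite ?normr0 //.
  have -> : phi a - phi 0 - c * a = (dphi s - c) * a by lra.
  by rewrite normrM ler_wpM2r // de.
- by rewrite subrr mulr0 subrr normr0 mulr0.
Qed.

Lemma le_mx_norm (h : 'rV[R]_n) j : `|h 0 j| <= `|h|.
Proof.
rewrite [leRHS]/Num.Def.normr /= mx_normrE.
exact: (le_bigmax _ (fun ij : 'I_1 * 'I_n => `|h ij.1 ij.2|) (0, j)).
Qed.

(** The increment is split along the coordinate directions, and continuity of the
   partial derivatives controls each part through the mean value theorem. *)
Lemma smooth_on_differentiable U f x : open U -> smooth_on U f -> U x ->
  differentiable f x.
Proof.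
move=> oU sf Ux.
pose df (h : 'rV[R]_n) : R := \sum_j h 0 j * 'D_(ebase j) f x.
have df_lin : linear df.
  move=> a h k; rewrite /df scaler_sumr -big_split /=; apply: eq_bigr => j _.
  by rewrite !mxE mulrDl; congr (_ + _); rewrite -mulrA.
pose dfM := GRing.isLinear.Build _ _ _ _ _ df_lin.
pose dfL : {linear 'rV[R]_n -> R} := HB.pack df dfM.
have dfc : continuous dfL.
  move=> h; pose B (g : 'rV[R]_n -> R) := exists j, g = (fun y => y 0 j).
  have Bc g : B g -> forall y, setT y -> {for y, continuous g}.
    by move=> [j ->] y _; exact: coord_continuous.
  apply: (@alg_cont R 'rV[R]_n B setT Bc df _ h I).
  apply: alg_bigsum => j; apply: alg_mul; last exact: alg_cst.
  by apply: alg_base; exists j.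
have := @diff_unique _ _ _ f dfL x dfc.
set littleo_eq := (X in (X -> _) -> _); suff dxf : littleo_eq.
  by move=> /(_ dxf) E; apply/diff_locallyP; split; rewrite E.
apply/eqaddoP => e e0.
pose e' := e / n.+1%:R.
have e'0 : 0 < e' by rewrite divr_gt0.
have [d d0 Hd] : exists2 d : R, 0 < d & forall y, ball x d y ->
   U y /\ forall j, `|'D_(ebase j) f y - 'D_(ebase j) f x| <= e'.
  have nU : \forall y \near x, U y by exact: open_nbhs_nbhs.
  have nD : \forall y \near x, forall j, `|'D_(ebase j) f y - 'D_(ebase j) f x| <= e'.
    near=> y; move=> j; move: j; near: y; apply: filter_forall => /= j.
    have /cvgrPdist_le/(_ _ e'0) := smooth_on_cont (smooth_on_partial j sf) Ux.
    by apply: filterS => y; rewrite distrC.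
  have : nbhs x (U `&` [set y | forall j, `|'D_(ebase j) f y - 'D_(ebase j) f x| <= e']).
    exact: filterI.
  by move=> /nbhs_ballP[d /= d0 Hd]; exists d => // y /Hd.
pose trunc (k : nat) (h : 'rV[R]_n) : 'rV[R]_n := \row_j (if (j < k)%N then h 0 j else 0).
have trunc_ball (h : 'rV[R]_n) k (j : 'I_n) (s : R) : `|h| < d -> `|s| <= `|h 0 j| ->
    j = k :> nat -> ball x d (trunc k h + s *: ebase j + x).
  move=> hd sh jk; split=> // i l; rewrite (ord1 i) {i}.
  rewrite /ball /= !mxE eqxx /= opprD addrCA subrr addr0 normrN.
  have [->|lj] := eqVneq l j.
    by rewrite jk ltnn add0r mulr1 (le_lt_trans sh) // (le_lt_trans (le_mx_norm _ _)).
  rewrite mulr0 addr0; case: ifP => _; last by rewrite normr0.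
  by rewrite (le_lt_trans (le_mx_norm _ _)).
have step (h : 'rV[R]_n) (k : nat) : `|h| < d -> (k <= n)%N ->
    `|f (trunc k h + x) - f x - df (trunc k h)| <= k%:R * (e' * `|h|).
  move=> hd; elim: k => [|k IH] kn.
    have -> : trunc 0 h = 0 by apply/rowP => j; rewrite !mxE.
    rewrite add0r subrr mul0r (_ : df 0 = 0) ?subr0 ?normr0 //.
    exact: (linear0 dfL).
  pose j := Ordinal kn.
  have tS : trunc k.+1 h = trunc k h + h 0 j *: ebase j.
    apply/rowP => l; rewrite !mxE eqxx /= ltnS leq_eqVlt.
    have [->|lj] := eqVneq l j; first by rewrite /= eqxx ltnn add0r mulr1.
    by rewrite mulr0 addr0 (_ : (l == k :> nat) = false) //; apply: negbTE.
  pose phi (s : R) := f (trunc k h + x + s *: ebase j).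
  have inU s : `|s| <= `|h 0 j| -> ball x d (trunc k h + x + s *: ebase j).
    by move=> sh; rewrite addrAC; exact: trunc_ball.
  have : `|phi (h 0 j) - phi 0 - 'D_(ebase j) f x * h 0 j| <= e' * `|h 0 j|.
    apply: (@MVT_error phi (fun s => 'D_(ebase j) f (trunc k h + x + s *: ebase j))).
      move=> s /inU /Hd[Us _]; apply: is_derive_lineE.
      exact: smooth_on_is_derive sf Us.
    by move=> s /inU /Hd[_ ->].
  have -> : phi (h 0 j) = f (trunc k.+1 h + x) by rewrite /phi tS addrAC.
  have -> : phi 0 = f (trunc k h + x) by rewrite /phi scale0r addr0.
  have dfS : df (trunc k.+1 h) = df (trunc k h) + 'D_(ebase j) f x * h 0 j.
    rewrite tS -[LHS]/(dfL _) linearD linearZ /=; congr (_ + _).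
    rewrite mulrC /GRing.scale /=; congr (_ * _); rewrite /df (bigD1 j) //= mxE !eqxx mul1r big1 ?addr0 //.
    by move=> l lj; rewrite mxE eqxx /= (negbTE lj) mul0r.
  have hj := le_mx_norm h j.
  have := IH (ltnW kn).
  rewrite dfS -natr1 mulrDl mul1r.
  set A := f (trunc k.+1 h + x); set B := f (trunc k h + x).
  set D := 'D_(ebase j) f x; set X := df (trunc k h) => IH' st.
  have -> : A - f x - (X + D * h 0 j) = (B - f x - X) + (A - B - D * h 0 j) by ring.
  apply: le_trans (ler_normD _ _) _; apply: lerD => //.
  by apply: le_trans st _; rewrite ler_pM2l.
near=> h.
have hd : `|h| < d.
  near: h; apply/nbhs_ballP; exists d => //= h.
  by rewrite -ball_normE /= sub0r normrN.
have := step h n hd (leqnn n).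
have -> : trunc n h = h by apply/rowP => j; rewrite mxE ltn_ord.
move=> /le_trans; rewrite /= opprD addrA; apply.
rewrite mulrA ler_wpM2r // /e' mulrCA ger_pMr // ler_pdivrMr // mul1r ler_nat.
exact: leqnSn.
Unshelve. all: by end_near. Qed.

Lemma chain_rule U f (c : R -> 'rV[R]_n) (t : R) (c' : 'I_n -> R) :
  open U -> smooth_on U f -> U (c t) ->
  (forall j, is_derive t 1 (fun s => c s 0 j) (c' j)) ->
  is_derive t 1 (fun s => f (c s)) (\sum_j c' j * 'D_(ebase j) f (c t)).
Proof.
move=> oU sf Uc dc.
have cd : derivable c t 1.
  by apply/derivable_mxP => i j; rewrite (ord1 i); have [] := dc j.
have vd : 'D_1 c t = \row_j c' j.
  rewrite derive_mx //; apply/rowP => j; rewrite !mxE.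
  by have [_ ->] := dc j.
have fd : differentiable f (c t) by exact: smooth_on_differentiable oU sf Uc.
have cD : differentiable c t by exact/derivable1_diffP.
have fcd : differentiable (f \o c) t by exact: differentiable_comp.
apply: DeriveDef; first by apply/derivable1_diffP.
have cdE : 'd c t 1 = \row_j c' j by rewrite -deriveE // vd.
rewrite deriveE // diff_comp //= cdE.
rewrite (_ : \row_j c' j = \sum_j c' j *: (ebase j : 'rV[R]_n)); last first.
  by rewrite [LHS]row_sum_delta; apply: eq_bigr => j _; rewrite mxE.
rewrite linear_sum /=; apply: eq_bigr => j _.
by rewrite linearZ /= -deriveE.
Qed.

Lemma is_derive_line U f (x v : 'rV[R]_n) (s : R) : open U -> smooth_on U f -> U (x + s *: v) ->
  is_derive s 1 (fun s : R => f (x + s *: v))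
    (\sum_j v 0 j * 'D_(ebase j) f (x + s *: v)).
Proof.
move=> oU sf Us; apply: (chain_rule (c := fun s => x + s *: v)) oU sf Us _ => j.
apply: (@is_derive_ext _ _ (fun s => x 0 j + v 0 j * s)) => [y|].
  by rewrite !mxE mulrC.
have := is_derive_add (is_derive_cstf s 1 (x 0 j)) (is_derive_mulc (v 0 j) s).
by rewrite add0r.
Qed.

Lemma is_derive_line2 U f (x v : 'rV[R]_n) : open U -> smooth_on U f -> U x ->
  is_derive (0 : R) 1 (fun s : R => \sum_j v 0 j * 'D_(ebase j) f (x + s *: v))
    ((v *m hessian f x *m v^T) 0 0).
Proof.
move=> oU sf Ux; rewrite mxE.
have U0 : U (x + (0 : R) *: v) by rewrite scale0r addr0.
pose h j := is_derive_mul (is_derive_cstf (0 : R) 1 (v 0 j))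
  (is_derive_line oU (smooth_on_partial j sf) U0).
apply: is_derive_eq (is_derive_bigsum _ h) _.
apply: eq_bigr => j _; rewrite mul0r add0r scale0r addr0 !mxE mulrC; congr (_ * _).
by apply: eq_bigr => i _; rewrite !mxE.
Qed.

End ChainRule.

(** * Euclidean geometry, and second derivatives along lines *)

Section EuclideanLemmas.
Variables (R : realType) (n : nat).
Implicit Types (x y z v : 'rV[R]_n) (a : R).

Lemma dotvC x y : dotv x y = dotv y x.
Proof. by apply: eq_bigr => i _; rewrite mulrC. Qed.

Lemma dotvDl x y z : dotv (x + y) z = dotv x z + dotv y z.
Proof. by rewrite /dotv -big_split; apply: eq_bigr => i _; rewrite mxE mulrDl. Qed.

Lemma dotvZl a x y : dotv (a *: x) y = a * dotv x y.
Proof. by rewrite /dotv mulr_sumr; apply: eq_bigr => i _; rewrite mxE mulrA. Qed.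

Lemma dotvDr x y z : dotv x (y + z) = dotv x y + dotv x z.
Proof. by rewrite dotvC dotvDl !(dotvC x). Qed.

Lemma dotvZr a x y : dotv x (a *: y) = a * dotv x y.
Proof. by rewrite dotvC dotvZl dotvC. Qed.

Lemma dotv_ge0 x : 0 <= dotv x x.
Proof. by apply: sumr_ge0 => i _; rewrite -expr2 sqr_ge0. Qed.

Lemma dotv_eq0 x : (dotv x x == 0) = (x == 0).
Proof.
apply/idP/eqP => [|->]; last by rewrite /dotv big1 // => i _; rewrite mxE mul0r.
rewrite /dotv psumr_eq0 => [/allP x0|i _]; last by rewrite -expr2 sqr_ge0.
apply/rowP => i; rewrite mxE.
by have := x0 i (mem_index_enum i); rewrite /= mulf_eq0 orbb => /eqP.
Qed.

Lemma dotv_gt0 x : x != 0 -> 0 < dotv x x.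
Proof. by move=> x0; rewrite lt_def dotv_ge0 dotv_eq0 x0. Qed.

Lemma enorm_ge0 x : 0 <= enorm x. Proof. exact: sqrtr_ge0. Qed.

Lemma sqr_enorm x : enorm x ^+ 2 = dotv x x.
Proof. by rewrite sqr_sqrtr // dotv_ge0. Qed.

Lemma enorm_gt0 x : x != 0 -> 0 < enorm x.
Proof. by move=> x0; rewrite sqrtr_gt0 dotv_gt0. Qed.

Lemma enorm0 : enorm (0 : 'rV[R]_n) = 0.
Proof. by rewrite /enorm (eqP (etrans (dotv_eq0 0) (eqxx _))) sqrtr0. Qed.

Lemma enormZ a x : enorm (a *: x) = `|a| * enorm x.
Proof.
by rewrite /enorm dotvZl dotvZr mulrA -expr2 sqrtrM ?sqr_ge0 // sqrtr_sqr.
Qed.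

Lemma sphere_dotv x : sphere x -> dotv x x = 1.
Proof. by rewrite -sqr_enorm => ->; rewrite expr1n. Qed.

Lemma dotv_sphere x : dotv x x = 1 -> sphere x.
Proof. by move=> h; rewrite /sphere /= /enorm h sqrtr1. Qed.

Lemma sphere_neq0 x : sphere x -> x != 0.
Proof. by move=> /sphere_dotv x1; rewrite -dotv_eq0 x1 oner_eq0. Qed.

Lemma sphere_normalize x : x != 0 -> sphere ((enorm x)^-1 *: x).
Proof.
move=> x0; have ex := enorm_gt0 x0.
by rewrite /sphere /= enormZ gtr0_norm ?invr_gt0 // mulVf // gt_eqF.
Qed.

Lemma normalizeK x : x != 0 -> x = enorm x *: ((enorm x)^-1 *: x).
Proof. by move=> x0; rewrite scalerA mulfV ?scale1r // gt_eqF // enorm_gt0. Qed.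

Lemma cauchy_schwarz x y : dotv x y ^+ 2 <= dotv x x * dotv y y.
Proof.
have [->|y0] := eqVneq y 0.
  by rewrite -[0](scale0r (0 : 'rV[R]_n)) !dotvZr !mul0r expr0n /= mulr0.
have := dotv_ge0 (dotv y y *: x + (- dotv x y) *: y).
rewrite !(dotvDl, dotvDr, dotvZl, dotvZr) (dotvC y x) => h.
suff : 0 <= dotv y y * (dotv x x * dotv y y - dotv x y ^+ 2).
  by rewrite pmulr_rge0 ?subr_ge0 // dotv_gt0.
by apply: le_trans h _; rewrite le_eqVlt; apply/orP; left; apply/eqP; ring.
Qed.

Lemma dotv_le1 x y : sphere x -> sphere y -> -1 <= dotv x y <= 1.
Proof.
move=> /sphere_dotv x1 /sphere_dotv y1; rewrite -ler_norml.
by rewrite -(@ler_pXn2r _ 2) ?nnegrE // expr1n real_normK ?num_real //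
  (le_trans (cauchy_schwarz x y)) // x1 y1 mulr1.
Qed.

Lemma open_neq0 : open [set x : 'rV[R]_n | x != 0].
Proof.
have -> : [set x : 'rV[R]_n | x != 0] = ~` [set 0].
  by apply/seteqP; split => x /=; [move=> /eqP|move=> ?; apply/eqP].
by apply: closed_openC; exact: accessible_closed_set1 (hausdorff_accessible _) _.
Qed.

Lemma continuous_coord_alg (f : 'rV[R]_n -> R) :
  alg (fun g => exists j, g = (fun y => y 0 j)) f -> continuous f.
Proof.
move=> Bf x; apply: (alg_cont (U := setT) _ Bf I).
by move=> _ [j ->] y _; exact: coord_continuous.
Qed.

Lemma continuous_dotv_alg (y : 'rV[R]_n) : continuous (fun x => dotv x y).
Proof.
apply: continuous_coord_alg; apply: alg_bigsum => j; apply: alg_mul.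
  by apply: alg_base; exists j.
exact: alg_cst.
Qed.

Lemma continuous_enorm : continuous (@enorm R n).
Proof.
move=> x; apply: (@continuous_comp _ _ _ (fun x => dotv x x) Num.sqrt).
  apply: continuous_coord_alg; apply: alg_bigsum => j.
  by apply: alg_mul; apply: alg_base; exists j.
exact: sqrt_continuous.
Qed.

Lemma is_derive_enorm x i : x != 0 ->
  is_derive x (ebase i) (@enorm R n) (x 0 i * (enorm x)^-1).
Proof.
move=> x0.
have d : is_derive x (ebase i) (fun x => dotv x x) (2 * x 0 i).
  pose h j := is_derive_mul (is_derive_coord x (ebase i) j)
    (is_derive_coord x (ebase i) j).
  have hs := is_derive_bigsum (index_enum _) h.
  apply: is_derive_eq hs _.
  rewrite (bigD1 i) //= big1 ?addr0; first by rewrite !mxE !eqxx /=; ring.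
  by move=> j ji; rewrite !mxE eqxx /= (negbTE ji) mul0r mulr0 addr0.
apply: is_derive_eq (is_derive_sqrt_comp (f := fun x => dotv x x) (dotv_gt0 x0) d) _.
by rewrite -/(enorm x) invfM mulrC; field; rewrite gt_eqF // enorm_gt0.
Qed.

Lemma smooth_on_enorm : smooth_on [set x : 'rV[R]_n | x != 0] (@enorm R n).
Proof.
pose B (g : 'rV[R]_n -> R) := [\/ g = @enorm R n, g = (fun x => (enorm x)^-1)
  | exists j, g = (fun y => y 0 j)].
have e0 x : x != 0 -> enorm x != 0 by move=> x0; rewrite gt_eqF // enorm_gt0.
have B1 : alg B (@enorm R n) by apply: alg_base; constructor 1.
have B2 : alg B (fun x => (enorm x)^-1) by apply: alg_base; constructor 2.
have B3 j : alg B (fun x => x 0 j) by apply: alg_base; constructor 3; exists j.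
apply: (@smooth_on_alg _ _ _ B open_neq0) => // [g Bg x x0|g Bg i].
  case: Bg => [->|->|[j ->]]; last exact: coord_continuous.
    exact: continuous_enorm.
  by apply: (cvgV (F := nbhs x)); [exact: (e0 x x0)|exact: continuous_enorm].
case: Bg => [->|->|[k ->]].
- exists (fun x => x 0 i * (enorm x)^-1); first exact: alg_mul.
  by move=> x x0; exact: is_derive_enorm.
- exists (fun x => - ((enorm x)^-1 ^+ 2) * (x 0 i * (enorm x)^-1)).
    by apply: alg_mul; [apply: alg_opp; exact: alg_exp|exact: alg_mul].
  move=> x x0; apply: is_derive_eq (is_derive_inv (e0 x x0) (is_derive_enorm i x0)) _.
  by rewrite exprVn.
- exists (fun=> ebase i 0 k); first exact: alg_cst.
  by move=> x _; exact: is_derive_coord.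
Qed.

End EuclideanLemmas.

Section SecondDerivative.
Variable R : realType.
Implicit Types (phi psi : R -> R).

(** The first derivative is asked for near [0] only, because a line may meet the
   origin, where norms are not smooth. *)
Definition second_derivative phi (c : R) : Prop :=
  exists2 phi1 : R -> R, (\forall s \near (0 : R), is_derive (s : R) 1 phi (phi1 s)) &
    is_derive (0 : R) 1 phi1 c.

Lemma second_derivative_unique phi psi a b :
  (\forall s \near (0 : R), phi s = psi s) ->
  second_derivative phi a -> second_derivative psi b -> a = b.
Proof.
move=> /near_join E [phi1 d1 da] [psi1 d2 db].
apply: is_derive_unique db; apply: near_eq_is_derive da.
near=> s.
have h : is_derive s 1 psi (phi1 s).
  by apply: (@near_eq_is_derive _ _ _ phi); near: s.
by apply: is_derive_unique h _; near: s.
Unshelve. all: by end_near. Qed.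

Lemma second_derivative_sub phi psi a b :
  second_derivative phi a -> second_derivative psi b ->
  second_derivative (fun s => phi s - psi s) (a - b).
Proof.
move=> [phi1 d1 da] [psi1 d2 db]; exists (fun s => phi1 s - psi1 s).
  by near=> s; apply: is_derive_sub; near: s.
exact: is_derive_sub.
Unshelve. all: by end_near. Qed.

Lemma second_derivative_min phi c : second_derivative phi c ->
  phi 0 = 0 -> (\forall s \near (0 : R), 0 <= phi s) -> 0 <= c.
Proof.
move=> [phi1 d1 dc] p0 pge; rewrite leNgt; apply/negP => c0.
have [e e0 He] : exists2 e : R, 0 < e & forall s : R, `|s| < e ->
    is_derive s 1 phi (phi1 s) /\ 0 <= phi s.
  have : nbhs (0 : R) [set s : R | is_derive s 1 phi (phi1 s) /\ 0 <= phi s].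
    exact: filterI.
  move=> /nbhs_ballP[e /= e0 He]; exists e => // s se; apply: He.
  by rewrite /ball /= sub0r normrN.
have {}He s : - e < s < e -> is_derive s 1 phi (phi1 s) /\ 0 <= phi s.
  by move=> se; apply: He; rewrite ltr_norml.
have p10 : phi1 0 = 0.
  apply: is_derive_unique (He 0 _).1 _; first by lra.
  apply: (@derive1_at_min _ phi (- e) e) => [|t||t]; rewrite ?in_itv /=.
  - lra.
  - by move=> /He[[]].
  - lra.
  - by move=> /He[_]; rewrite p0.
have [q [qE qc q0]] := (is_derive1_caratheodory _ _ _).1 dc.
have : \forall s \near (0 : R), q s < 0.
  have /cvgrPdist_lt/(_ (- c)) := qc; rewrite oppr_gt0 => /(_ c0).
  apply: filterS => s; rewrite q0 ltr_norml => /andP[]; lra.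
move=> /nbhs_ballP[d /= d0 Hd].
pose s := Num.min d e / 2.
have m0 : 0 < Num.min d e by rewrite lt_min d0 e0.
have s0 : 0 < s by rewrite divr_gt0.
have [sd se] : s < d /\ s < e.
  have : s < Num.min d e by rewrite /s; lra.
  by rewrite lt_min => /andP.
have [||r] := @MVT _ phi phi1 0 s s0.
- move=> x; rewrite in_itv /= => /andP[x0 xs]; by apply: (He x _).1; lra.
- apply: continuous_in_subspaceT => x; rewrite inE /= in_itv /= => /andP[x0 xs].
  have [|dx _] := He x; first by lra.
  exact: is_derive_cont dx.
rewrite in_itv /= => /andP[r0 rs] E.
have [|_] := He s; first by lra.
move: E; rewrite p0 !subr0 => ->.
have := qE r; rewrite p10 !subr0 => ->.
have qr : q r < 0.
  by apply: Hd; rewrite /ball /= sub0r normrN ltr_norml; lra.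
rewrite leNgt => /negP; apply.
by rewrite pmulr_llt0 // pmulr_llt0.
Unshelve. all: by end_near. Qed.

Lemma near_line n (x v : 'rV[R]_n) (U : set 'rV[R]_n) : open U -> U x ->
  \forall s \near (0 : R), U (x + s *: v).
Proof.
move=> oU Ux.
have c : (x + s *: v) @[s --> (0 : R)] --> x + (0 : R) *: v.
  by apply: cvgD; [exact: cvg_cst|apply: cvgZr_tmp; exact: cvg_id].
by apply: c; rewrite scale0r addr0; exact: open_nbhs_nbhs.
Qed.

Lemma second_derivative_line n (U : set 'rV[R]_n) f x v : open U ->
  smooth_on U f -> U x ->
  second_derivative (fun s => f (x + s *: v)) ((v *m hessian f x *m v^T) 0 0).
Proof.
move=> oU sf Ux; exists (fun s => \sum_j v 0 j * 'D_(ebase j) f (x + s *: v)).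
  near=> s; apply: (is_derive_line oU sf).
  by near: s; exact: (near_line v oU Ux).
exact: is_derive_line2 oU sf Ux.
Unshelve. all: by end_near. Qed.

End SecondDerivative.

(** * Restriction of norms to planes, and norms of the plane *)

Section MinkowskiGeneral.
Variables (R : realType) (n : nat).
Implicit Types (F : 'rV[R]_n -> R).

Lemma smooth_on_energy F : minkowski_norm F ->
  smooth_on [set x | x != 0] (fun x => F x ^+ 2 / 2).
Proof.
case=> _ _ sF _ _; apply: smooth_on_algE; first exact: open_neq0.
apply: alg_mul; last exact: alg_cst.
by apply: alg_exp; exact: alg_base.
Qed.

End MinkowskiGeneral.

Section Restriction.
Variables (R : realType) (n : nat) (y v : 'rV[R]_n).
Hypotheses (y1 : dotv y y = 1) (v1 : dotv v v = 1) (yv : dotv y v = 0).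

Definition plane_map (x : 'rV[R]_2) : 'rV[R]_n := x 0 0 *: y + x 0 1 *: v.

Lemma plane_map_line x w (s : R) :
  plane_map (x + s *: w) = plane_map x + s *: plane_map w.
Proof.
by rewrite /plane_map !mxE !scalerDl scalerDr !scalerA addrACA.
Qed.

Lemma plane_map_eq0 x : plane_map x = 0 -> x = 0.
Proof.
move=> x0.
have a0 : x 0 0 = 0.
  have := dotvDl (x 0 0 *: y) (x 0 1 *: v) y.
  rewrite -/(plane_map x) x0 !dotvZl (dotvC v y) y1 yv mulr0 mulr1 addr0 => <-.
  by rewrite /dotv big1 // => i _; rewrite mxE mul0r.
have b0 : x 0 1 = 0.
  have := dotvDl (x 0 0 *: y) (x 0 1 *: v) v.
  rewrite -/(plane_map x) x0 !dotvZl v1 yv mulr0 mulr1 add0r => <-.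
  by rewrite /dotv big1 // => i _; rewrite mxE mul0r.
apply/rowP => i; rewrite mxE; have [->|->] : i = 0 \/ i = 1 => //.
by case: i => [[|[|//]] hi]; [left|right]; exact: val_inj.
Qed.

Lemma plane_map_neq0 x : x != 0 -> plane_map x != 0.
Proof. by apply: contra_neq => /plane_map_eq0. Qed.

Lemma continuous_plane_map : continuous plane_map.
Proof.
move=> x; apply: (@cvgD _ _ _ (nbhs x)); apply: (@cvgZr_tmp _ _ _ (nbhs x));
exact: coord_continuous.
Qed.

Lemma smooth_on_plane u : smooth_on [set x | x != 0] u ->
  smooth_on [set x | x != 0] (u \o plane_map).
Proof.
move=> su.
pose B (f : 'rV[R]_2 -> R) :=
  exists2 u, smooth_on [set x | x != 0] u & f = u \o plane_map.
apply: (@smooth_on_alg _ _ _ B (@open_neq0 R 2)).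
- move=> _ [w sw ->] x x0; apply: continuous_comp; first exact: continuous_plane_map.
  by apply: smooth_on_cont sw _; exact: plane_map_neq0.
- move=> _ [w sw ->] i.
  exists (fun x => \sum_j plane_map (ebase i) 0 j * 'D_(ebase j) w (plane_map x)).
    apply: alg_bigsum => j; apply: alg_mul; first exact: alg_cst.
    apply: alg_base; exists ('D_(ebase j) w) => //.
    exact: smooth_on_partial.
  move=> x x0; apply: is_derive_of_line.
  apply: (@is_derive_ext R R (fun s : R => w (plane_map x + s *: plane_map (ebase i)))).
    by move=> s; rewrite /= plane_map_line.
  have U0 : [set x | x != 0] (plane_map x + (0 : R) *: plane_map (ebase i)).
    by rewrite scale0r addr0; exact: plane_map_neq0.
  have := is_derive_line (@open_neq0 R n) sw U0.
  by rewrite scale0r addr0.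
- by apply: alg_base; exists u.
Qed.

(** The Hessian as a quadratic form is the second derivative along lines, and
   lines of the plane are lines of the space. *)
Lemma minkowski_norm_plane F : minkowski_norm F -> minkowski_norm (F \o plane_map).
Proof.
move=> FM; have sE := smooth_on_energy FM.
case: (FM) => -[cF F0] Fp sF hF pF; split.
- split; last by move=> x; exact: F0.
  by move=> x; apply: continuous_comp; [exact: continuous_plane_map|exact: cF].
- by move=> x x0; apply: Fp; exact: plane_map_neq0.
- exact: smooth_on_plane.
- move=> l x l0; rewrite /= -hF //; congr F.
  by rewrite /plane_map !mxE scalerDr !scalerA.
move=> x x0 w w0.
suff -> : (w *m hessian (fun z => (F \o plane_map) z ^+ 2 / 2) x *m w^T) 0 0 =
   (plane_map w *m hessian (fun z => F z ^+ 2 / 2) (plane_map x)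
     *m (plane_map w)^T) 0 0.
  by apply: pF; exact: plane_map_neq0.
apply: (@second_derivative_unique _
    (fun s => (F (plane_map (x + s *: w))) ^+ 2 / 2)
    (fun s => (F (plane_map x + s *: plane_map w)) ^+ 2 / 2)).
- by near=> s; rewrite plane_map_line.
- have sE2 := smooth_on_plane sE.
  exact: (second_derivative_line w (@open_neq0 R 2) sE2 x0).
- apply: (second_derivative_line (plane_map w) (@open_neq0 R n) sE).
  exact: plane_map_neq0.
Unshelve. all: by end_near. Qed.

End Restriction.

Section PlanarNorms.
Variable R : realType.
Implicit Types (N : 'rV[R]_2 -> R).

Definition cis (t : R) : 'rV[R]_2 := vec2 (cos t) (sin t).

Lemma vec2_neq0 (a b : R) : a ^+ 2 + b ^+ 2 != 0 -> vec2 a b != 0.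
Proof.
apply: contra_neq => /rowP h; have := h 0; have := h 1.
by rewrite !mxE /= => -> ->; rewrite !expr0n addr0.
Qed.

Lemma cis_neq0 t : cis t != 0.
Proof. by apply: vec2_neq0; rewrite cos2Dsin2 oner_eq0. Qed.

Lemma smooth1_cis u : smooth_on [set x | x != 0] u -> smooth1 (fun t => u (cis t)).
Proof.
move=> su.
pose B (f : R -> R) := smooth1 f \/
  exists2 u, smooth_on [set x | x != 0] u & f = (fun t => u (cis t)).
apply: (@smooth1_alg R B); last by apply: alg_base; right; exists u.
move=> f [sf|[w sw ->]].
  exists (derive1 f); first by apply: alg_base; left; exact: smooth1_derive.
  by move=> t; exact: smooth1_is_derive.
pose c' (j : 'I_2) (t : R) := if j == 0 then - sin t else cos t.
exists (fun t => \sum_j c' j t * 'D_(ebase j) w (cis t)).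
  apply: alg_bigsum => j; apply: alg_mul.
    apply: alg_base; left; rewrite /c'; case: (j == 0).
      exact/smooth1_opp/smooth1_sin.
    exact: smooth1_cos.
  by apply: alg_base; right; exists ('D_(ebase j) w) => //; exact: smooth_on_partial.
move=> t; apply: (chain_rule (@open_neq0 R 2) sw); first exact: cis_neq0.
move=> j; rewrite /c'; case: eqP => j0.
  by apply: (@is_derive_ext R R cos _ t 1 _ _ (is_derive_cos t)) => s; rewrite mxE j0.
apply: (@is_derive_ext R R sin _ t 1 _ _ (is_derive_sin t)) => s.
by rewrite mxE; move/eqP/negbTE: j0 => ->.
Qed.

(** The circle as a radial rescaling of its tilted tangent line at [t0]: the
   energy along this line is then explicit in its values on the circle. *)
Lemma cis_shift (mu t0 t : R) : let m := cos t - mu * sin t in m != 0 ->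
  cis (t0 + t) = m *: (cis t0 + (sin t / m) *:
    vec2 (mu * cos t0 - sin t0) (mu * sin t0 + cos t0)).
Proof.
move=> m m0; apply/rowP => j; rewrite !mxE.
have -> a b : m * (a + sin t / m * b) = m * a + sin t * b by field.
by case: (j == 0); rewrite ?cosD ?sinD /m; ring.
Qed.

(** The right-hand side is the second derivative of the energy at [cis t0] in the
   direction [mu *: cis t0 + cis (t0 + pi / 2)]. It is found by differentiating
   twice the homogeneity relation along the line of [cis_shift]. *)
Lemma planar_energy_ineq N (g := fun t => N (cis t) ^+ 2 / 2) :
  minkowski_norm N -> forall t0 mu : R,
  0 < derive1n 2 g t0 + 2 * mu * derive1 g t0 + (2 * mu ^+ 2 + 2) * g t0.
Proof.
move=> NM t0 mu.
have sE := smooth_on_energy NM; case: (NM) => _ _ _ hN pN.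
have sg : smooth1 g by exact: smooth1_cis sE.
pose w := vec2 (mu * cos t0 - sin t0) (mu * sin t0 + cos t0).
have w0 : w != 0.
  apply: vec2_neq0; rewrite (_ : _ + _ = 1 + mu ^+ 2).
    by rewrite gt_eqF // ltr_pwDl // sqr_ge0.
  have := cos2Dsin2 t0; set c := cos t0; set s := sin t0 => cs.
  rewrite -cs; have -> : mu ^+ 2 = mu ^+ 2 * (c ^+ 2 + s ^+ 2) by rewrite cs mulr1.
  ring.
pose psi (s : R) := N (cis t0 + s *: w) ^+ 2 / 2.
pose psi1 (s : R) := \sum_j w 0 j * 'D_(ebase j) (fun x => N x ^+ 2 / 2) (cis t0 + s *: w).
pose c := (w *m hessian (fun x => N x ^+ 2 / 2) (cis t0) *m w^T) 0 0.
have c0 : 0 < c by apply: pN => //; exact: cis_neq0.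
have dpsi1 : is_derive (0 : R) 1 psi1 c.
  apply: (is_derive_line2 w (@open_neq0 R 2) sE); exact: cis_neq0.
pose m (t : R) := cos t - mu * sin t.
pose m' (t : R) := - sin t - mu * cos t.
have dm (t : R) : is_derive t 1 m (m' t).
  apply: is_derive_eq (is_derive_sub (is_derive_cos t)
    (is_derive_mul (is_derive_cstf t 1 mu) (is_derive_sin t))) _.
  by rewrite mul0r add0r.
have dm' (t : R) : is_derive t 1 m' (- m t).
  apply: is_derive_eq (is_derive_sub (is_derive_opp (is_derive_sin t))
    (is_derive_mul (is_derive_cstf t 1 mu) (is_derive_cos t))) _.
  by rewrite mul0r add0r /m; ring.
pose r (t : R) := sin t / m t.
have dr (t : R) : m t != 0 -> is_derive t 1 r ((m t ^+ 2)^-1).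
  move=> mt; apply: is_derive_eq (is_derive_mul (is_derive_sin t)
    (is_derive_inv mt (dm t))) _.
  have -> : cos t * (m t)^-1 + sin t * (- m t ^- 2 * m' t)
    = (cos t * m t - sin t * m' t) / m t ^+ 2 by field.
  have -> : cos t * m t - sin t * m' t = 1.
    by rewrite -(cos2Dsin2 t) /m /m'; ring.
  by rewrite mul1r.
have m0 : m 0 = 1 by rewrite /m sin0 cos0 mulr0 subr0.
have m'0 : m' 0 = - mu by rewrite /m' sin0 cos0 mulr1 oppr0 add0r.
have r0 : r 0 = 0 by rewrite /r sin0 mul0r.
have near_m : \forall t \near (0 : R), 0 < m t.
  have : m t @[t --> (0 : R)] --> m 0 by exact: is_derive_cont (dm 0).
  move=> /cvgrPdist_lt/(_ 1 ltr01); apply: filterS => t.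
  by rewrite m0 ltr_norml => /andP[]; lra.
have cisE t : 0 < m t -> cis (t0 + t) = m t *: (cis t0 + r t *: w).
  by move=> mt; apply: cis_shift; rewrite gt_eqF.
have gE t : 0 < m t -> g (t0 + t) = m t ^+ 2 * psi (r t).
  by move=> mt; rewrite /g cisE // hN ?ltW // /psi exprMn mulrA.
have dpsi t : 0 < m t -> is_derive (r t) 1 psi (psi1 (r t)).
  move=> mt; apply: (is_derive_line (@open_neq0 R 2) sE) => /=.
  by have := cis_neq0 (t0 + t); rewrite cisE // scaler_eq0 negb_or => /andP[].
have dg (t : R) : is_derive t 1 (fun s => g (t0 + s)) (derive1 g (t0 + t)).
  have d := is_derive_add (is_derive_cstf t 1 t0) (is_derive_id t 1).
  rewrite add0r in d.
  have := is_derive_compV (smooth1_is_derive (t0 + t) sg) d.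
  by rewrite mulr1.
have dgE : \forall t \near (0 : R),
    2 * m t * m' t * psi (r t) + psi1 (r t) = derive1 g (t0 + t).
  have near_m2 := near_join near_m.
  near=> t.
  have mt : 0 < m t by near: t.
  have mt0 : m t != 0 by rewrite gt_eqF.
  have d : is_derive t 1 (fun s => g (t0 + s))
     (2 * m t * m' t * psi (r t) + psi1 (r t)).
    apply: (@near_eq_is_derive _ _ _ (fun s => m s ^+ 2 * psi (r s))).
      have nt : \forall s \near t, 0 < m s by near: t.
      by apply: filterS nt => s ms; rewrite gE.
    apply: is_derive_eq (is_derive_mul (is_derive_exp 2 (dm t))
      (is_derive_compV (dpsi t mt) (dr t mt0))) _.
    by rewrite /= expr1; field.
  exact: is_derive_unique d (dg t).
have d2 : is_derive (0 : R) 1 (fun t => derive1 g (t0 + t)) (derive1n 2 g t0).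
  have d := is_derive_add (is_derive_cstf (0 : R) 1 t0) (is_derive_id (0 : R) 1).
  rewrite add0r in d.
  have := is_derive_compV (f := fun t => t0 + t)
    (smooth1_is_derive (t0 + 0) (smooth1_derive sg)) d.
  by rewrite mulr1 addr0.
have d2' : is_derive (0 : R) 1 (fun t => derive1 g (t0 + t))
    ((2 * mu ^+ 2 - 2) * psi 0 - 2 * mu * psi1 0 + c).
  apply: near_eq_is_derive dgE _.
  have m00 : m 0 != 0 by rewrite m0 oner_eq0.
  have dr0 := dr 0 m00.
  have dpsi0 : is_derive (r 0) 1 psi (psi1 (r 0)) by apply: dpsi; rewrite m0.
  have dpsi10 : is_derive (r 0) 1 psi1 c by rewrite r0.
  apply: is_derive_eq (is_derive_add (is_derive_mul (is_derive_mul
    (is_derive_mul (is_derive_cstf (0 : R) 1 2) (dm 0)) (dm' 0))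
    (is_derive_compV dpsi0 dr0)) (is_derive_compV dpsi10 dr0)) _.
  by rewrite m0 m'0 r0 expr1n invr1; ring.
have E2 := is_derive_unique d2 d2'.
have E0 : g t0 = psi 0 by have := gE 0; rewrite m0 r0 addr0 expr1n mul1r => ->.
have E1 : derive1 g t0 = - 2 * mu * psi 0 + psi1 0.
  have := nbhs_singleton dgE; rewrite m0 m'0 r0 addr0 => <-; ring.
rewrite E2 E1 E0.
have -> : (2 * mu ^+ 2 - 2) * psi 0 - 2 * mu * psi1 0 + c
   + 2 * mu * (- 2 * mu * psi 0 + psi1 0) + (2 * mu ^+ 2 + 2) * psi 0 = c by ring.
exact: c0.
Unshelve. all: by end_near. Qed.

Lemma planar_minkowski_ineq N (g := fun t => N (cis t) ^+ 2 / 2) :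
  minkowski_norm N ->
  [/\ smooth1 g, forall t, 0 < g t &
    forall t, 0 < 2 * g t * derive1n 2 g t - derive1 g t ^+ 2 + 4 * g t ^+ 2].
Proof.
move=> NM; case: (NM) => _ Np sN _ _.
have g0 t : 0 < g t by rewrite divr_gt0 // exprn_gt0 // Np // cis_neq0.
split => //; first exact: smooth1_cis (smooth_on_energy NM).
move=> t; have gt := g0 t.
(* The value of [mu] that minimizes the quadratic polynomial. *)
have := planar_energy_ineq NM t (- derive1 g t / (2 * g t)).
rewrite -/g -/(g t); set G := g t; set G1 := derive1 g t; set G2 := derive1n 2 g t.
have G0 : 0 < 2 * G by rewrite mulr_gt0.
move=> /(mulr_gt0 G0).
set lhs := (X in 0 < X -> _); set rhs := (X in _ -> 0 < X).
suff -> : lhs = rhs by [].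
by rewrite /lhs /rhs; field; rewrite gt_eqF.

Qed.

End PlanarNorms.

(** * Extremal binary forms *)

Section Forms.
Variable R : realType.
Implicit Types (c : nat -> R) (h : R -> R -> R).

Definition form (d : nat) c (a b : R) : R :=
  \sum_(k < d.+1) c k * a ^+ (d - k) * b ^+ k.

Definition is_form (d : nat) h : Prop := exists c, forall a b, h a b = form d c a b.

Lemma is_form_add d h1 h2 : is_form d h1 -> is_form d h2 ->
  is_form d (fun a b => h1 a b + h2 a b).
Proof.
move=> [c1 E1] [c2 E2]; exists (fun k => c1 k + c2 k) => a b.
by rewrite E1 E2 /form -big_split; apply: eq_bigr => k _; rewrite !mulrDl.
Qed.

Lemma is_form_scale d h (x : R) : is_form d h -> is_form d (fun a b => x * h a b).
Proof.
move=> [c E]; exists (fun k => x * c k) => a b.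
by rewrite E /form mulr_sumr; apply: eq_bigr => k _; rewrite !mulrA.
Qed.

Lemma is_form0 d : is_form d (fun a b => 0).
Proof. by exists (fun=> 0) => a b; rewrite /form big1 // => k _; rewrite !mul0r. Qed.

Lemma is_form_mul_linear d h (x y : R) : is_form d h ->
  is_form d.+1 (fun a b => (x * a + y * b) * h a b).
Proof.
move=> hf.
have ha : is_form d.+1 (fun a b => a * h a b).
  have [c E] := hf; exists (fun k => if (k <= d)%N then c k else 0) => a b.
  rewrite E /form [RHS]big_ord_recr /= ltnn !mul0r addr0 mulr_sumr.
  apply: eq_bigr => k _; rewrite -ltnS ltn_ord subSn -1?ltnS // exprS; ring.
have hb : is_form d.+1 (fun a b => b * h a b).
  have [c E] := hf; exists (fun k => if k is j.+1 then c j else 0) => a b.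
  rewrite E /form [RHS]big_ord_recl /= !mul0r add0r mulr_sumr.
  by apply: eq_bigr => k _; rewrite /bump /= add1n subSS exprS; ring.
have [c E] := is_form_add (is_form_scale x ha) (is_form_scale y hb).
by exists c => a b; rewrite -E; ring.
Qed.

Lemma is_form_mul_pow d h (x y : R) m : is_form d h ->
  is_form (m + d) (fun a b => (x * a + y * b) ^+ m * h a b).
Proof.
move=> hf; elim: m => [|m IH].
  by have [c E] := hf; exists c => a b; rewrite expr0 mul1r E.
have [c E] := is_form_mul_linear x y IH.
by exists c => a b; rewrite exprS -mulrA E addSn.
Qed.

Lemma is_form_prod (I : Type) (r : seq I) (m : I -> nat) (x y : I -> R) :
  is_form (\sum_(i <- r) m i) (fun a b => \prod_(i <- r) (x i * a + y i * b) ^+ m i).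
Proof.
elim: r => [|i r IH].
  rewrite big_nil; exists (fun=> 1) => a b.
  by rewrite big_nil /form big_ord_recl big_ord0 subnn !expr0 !mulr1 addr0.
rewrite big_cons; have [c E] := is_form_mul_pow (x i) (y i) (m i) IH.
by exists c => a b; rewrite big_cons E.
Qed.

Lemma is_form_sum (I : eqType) d (r : seq I) (h : I -> R -> R -> R) :
  (forall i, i \in r -> is_form d (h i)) ->
  is_form d (fun a b => \sum_(i <- r) h i a b).
Proof.
elim: r => [|i r IH] hr.
  by have [c E] := is_form0 d; exists c => a b; rewrite big_nil -E.
have [|c E] := is_form_add (hr i (mem_head _ _)) (IH _).
  by move=> j jr; apply: hr; rewrite inE jr orbT.
by exists c => a b; rewrite big_cons E.
Qed.

(** On a plane the coordinates are linear forms, so a monomial of degree [d]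
   becomes a product of [d] linear forms. *)
Lemma is_form_plane n d (P : mpoly.mpoly n R) (y v : 'rV[R]_n) :
  P \is mpoly.ishomog1 d mpoly.mdeg ->
  is_form d (fun a b => mpoly.meval (fun i => (a *: y + b *: v) 0 i) P).
Proof.
move=> /mpoly.dhomogP hP.
have [|c E] := @is_form_sum _ d (mpoly.msupp P) (fun m a b =>
    mpoly.mcoeff m P * \prod_i (y 0 i * a + v 0 i * b) ^+ m i).
  move=> m mP; apply: is_form_scale.
  have <- : mpoly.mdeg m = d by exact: hP.
  by rewrite mpoly.mdegE; exact: is_form_prod.
exists c => a b; rewrite -E mpoly.mevalE; apply: eq_bigr => m _; congr (_ * _).
by apply: eq_bigr => i _; rewrite !mxE ![_ * a]mulrC ![_ * b]mulrC.
Qed.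

Lemma is_derive_form d c (t : R) :
  is_derive t 1 (fun s => form d c (cos s) (sin s))
    (\sum_(k < d.+1) (c k * ((d - k)%:R * cos t ^+ (d - k).-1 * - sin t) * sin t ^+ k
       + c k * cos t ^+ (d - k) * (k%:R * sin t ^+ k.-1 * cos t))).
Proof.
have h (k : 'I_d.+1) := is_derive_mul (is_derive_mul (is_derive_cstf t 1 (c k))
  (is_derive_exp (d - k) (is_derive_cos t))) (is_derive_exp k (is_derive_sin t)).
apply: is_derive_eq (is_derive_bigsum (index_enum _) h) _.
by apply: eq_bigr => k _; rewrite mul0r add0r.
Qed.

(** In the slope [tan t] the form is a polynomial with more roots than its
   degree. *)
Lemma form_arc0 d c (t0 : R) : 0 < t0 ->
  (forall t, 0 <= t <= t0 -> form d c (cos t) (sin t) = 0) ->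
  forall a b, form d c a b = 0.
Proof.
move=> t00 H.
pose q := \poly_(k < d.+1) c k.
pose u0 := tan (Num.min t0 (pi / 4)).
have pi4 : 0 < pi / 4 :> R by rewrite divr_gt0 // pi_gt0.
have m0 : 0 < Num.min t0 (pi / 4) by rewrite lt_min t00.
have mpi : Num.min t0 (pi / 4) < pi / 2.
  by rewrite gt_min; apply/orP; right; have := @pi_gt0 R; lra.
have u00 : 0 < u0.
  rewrite -tan0 ltr_tan // in_itv /=; apply/andP; split => //.
  - by have := @pi_gt0 R; lra.
  - by have := @pi_gt0 R; lra.
  - by have := @pi_gt0 R; lra.
have root_q u : 0 <= u <= u0 -> root q u.
  move=> /andP[u1 u2]; apply/eqP; rewrite horner_poly.
  have ca : cos (atan u) != 0.
    by rewrite gt_eqF // cos_gt0_pihalf // atan_gtNpi2 atan_ltpi2.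
  have su : sin (atan u) = u * cos (atan u) by rewrite -[LHS](divfK ca) -/(tan _) atanK.
  have at0 : 0 <= atan u <= t0.
    have a1 : atan u <= atan u0 by exact: le_atan.
    have a2 : atan 0 <= atan u by exact: le_atan.
    rewrite atan0 in a2; rewrite a2 /=; apply: le_trans a1 _.
    rewrite tanK ?ge_min ?lexx // in_itv /=; apply/andP; split => //.
    by have := @pi_gt0 R; lra.
  have := H _ at0; rewrite /form su => E.
  apply: (@mulfI _ (cos (atan u) ^+ d)); first by rewrite expf_neq0.
  rewrite mulr0 -[RHS]E mulr_sumr; apply: eq_bigr => k _.
  have kd : (k <= d)%N by rewrite -ltnS.
  have -> : cos (atan u) ^+ d = cos (atan u) ^+ (d - k) * cos (atan u) ^+ k.
    by rewrite -exprD subnK.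
  by rewrite exprMn; ring.
have q0 : q = 0.
  apply/eqP; apply: contraT => qn0.
  pose r := [seq u0 / k.+1%:R | k <- iota 0 d.+2].
  have /(max_poly_roots qn0) : all (root q) r.
    apply/allP => u /mapP[k _ ->]; apply: root_q; rewrite divr_ge0 ?(ltW u00) //=.
    by rewrite ler_pdivrMr // ler_peMr ?(ltW u00) // ler1n.
  rewrite map_inj_uniq ?iota_uniq => [/(_ isT)|k l].
    by rewrite size_map size_iota ltnNge (leq_trans (size_poly _ _)).
  move=> /(mulfI (lt0r_neq0 u00))/invr_inj/eqP; rewrite eqr_nat eqSS.
  by move=> /eqP.
move=> a b; rewrite /form big1 // => k _.
have := congr1 (fun p : {poly R} => p`_k) q0.
by rewrite coef_poly ltn_ord coef0 => ->; rewrite !mul0r.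
Qed.

Lemma form_sub d c1 c2 a b :
  form d c1 a b - form d c2 a b = form d (fun k => c1 k - c2 k) a b.
Proof.
rewrite /form -sumrB; apply: eq_bigr => k _.
by rewrite !mulrBl.
Qed.

Lemma form_arc_eq d c1 c2 (t0 : R) : 0 < t0 ->
  (forall t, 0 <= t <= t0 -> form d c1 (cos t) (sin t) = form d c2 (cos t) (sin t)) ->
  forall a b, form d c1 a b = form d c2 a b.
Proof.
move=> t00 H a b; apply/eqP; rewrite -subr_eq0 form_sub.
apply/eqP; apply: (form_arc0 t00) => t ht.
by rewrite -form_sub H // subrr.
Qed.

End Forms.

Section ExtremalForms.
Variable R : realType.
Implicit Types (c : nat -> R).

Lemma sin_pi6 : sin (pi / 6) = 2^-1 :> R.
Proof.
have pi0 := @pi_gt0 R.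
have s0 : 0 < sin (pi / 6) :> R by apply: sin_gt0_pihalf; lra.
have E1 : cos (pi / 6 + pi / 6) = sin (pi / 6) :> R.
  have -> : pi / 6 + pi / 6 = pi / 2 - pi / 6 :> R by field.
  by rewrite cosB cos_pihalf sin_pihalf mul0r add0r mul1r.
move: E1; rewrite cosD; have := cos2Dsin2 (pi / 6 : R).
set s := sin _ in s0 *; set k := cos _ => h1 h2.
have : (2 * s - 1) * (s + 1) = 0 by nra.
by move=> /eqP; rewrite mulf_eq0 => /orP[] /eqP; lra.
Qed.

Lemma cos_pi6_gt0 : 0 < cos (pi / 6) :> R.
Proof. by have := @pi_gt0 R; move=> ?; apply: cos_gt0_pihalf; lra. Qed.

Lemma cos2_pi6 : cos (pi / 6) ^+ 2 = 3 / 4 :> R.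
Proof. by rewrite cos2sin2 sin_pi6; field. Qed.

Lemma cos_pi3 : cos (pi / 3) = 2^-1 :> R.
Proof.
have -> : pi / 3 = pi / 2 - pi / 6 :> R by field.
by rewrite cosB cos_pihalf sin_pihalf mul0r add0r mul1r sin_pi6.
Qed.

Lemma sin_pi3 : sin (pi / 3) = cos (pi / 6) :> R.
Proof.
have -> : pi / 3 = pi / 2 - pi / 6 :> R by field.
by rewrite sinB cos_pihalf sin_pihalf mul0r subr0 mul1r.
Qed.

Lemma cos_pi4_gt0 : 0 < cos (pi / 4) :> R.
Proof. by have := @pi_gt0 R; move=> ?; apply: cos_gt0_pihalf; lra. Qed.

Lemma sin_pi4 : sin (pi / 4) = cos (pi / 4) :> R.
Proof.
have k := cos_pi4_gt0; have := @tan_piquarter R; rewrite /tan => h.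
by rewrite -[LHS](divfK (lt0r_neq0 k)) h mul1r.
Qed.

Lemma cos2_pi4 : cos (pi / 4) ^+ 2 = 1 / 2 :> R.
Proof. by have := cos2Dsin2 (pi / 4 : R); rewrite sin_pi4; lra. Qed.

Section Extremal.
Variables (d : nat) (c : nat -> R).
Hypothesis bound : forall t, -1 <= form d c (cos t) (sin t) <= 1.

(** A linear equation in the coefficients, in addition to the value. *)
Lemma form_extremum t : form d c (cos t) (sin t) = 1 \/ form d c (cos t) (sin t) = -1 ->
    \sum_(k < d.+1) (c k * ((d - k)%:R * cos t ^+ (d - k).-1 * - sin t) * sin t ^+ k
       + c k * cos t ^+ (d - k) * (k%:R * sin t ^+ k.-1 * cos t)) = 0.
Proof.
move=> ext; apply: is_derive_unique (is_derive_form d c t) _.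
have tt : t - 1 <= t + 1 by lra.
have ti : t \in `]t - 1, t + 1[ by rewrite in_itv /=; lra.
case: ext => E; [apply: derive1_at_max tt _ ti _|apply: derive1_at_min tt _ ti _].
- by move=> s _; have [] := is_derive_form d c s.
- by move=> s _; rewrite E; have /andP[] := bound s.
- by move=> s _; have [] := is_derive_form d c s.
- by move=> s _; rewrite E; have /andP[] := bound s.
Qed.

End Extremal.

Lemma extremal_form1 c : (forall t, -1 <= form 1 c (cos t) (sin t) <= 1) ->
  form 1 c (cos 0) (sin 0) = 1 ->
  forall t, form 1 c (cos t) (sin t) = cos t.
Proof.
move=> b e0 t; have := form_extremum b (or_introl e0); move: e0.
rewrite /form !big_ord_recr !big_ord0 /= cos0 sin0 => e0 d0.
have -> : c 0%N = 1 by move: e0; rewrite ?(expr0, expr1, subn0, subnn); lra.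
have -> : c 1%N = 0 by move: d0; rewrite ?(expr0, expr1, subn0, subnn); lra.
by rewrite subn0 subnn; ring.
Qed.

Lemma extremal_form2 c : (forall t, -1 <= form 2 c (cos t) (sin t) <= 1) ->
  form 2 c (cos 0) (sin 0) = 1 -> form 2 c (cos (pi / 2)) (sin (pi / 2)) = -1 ->
  forall t, form 2 c (cos t) (sin t) = cos (2 * t).
Proof.
move=> b e0 e1 t; have := form_extremum b (or_introl e0); move: e0 e1.
rewrite /form !big_ord_recr !big_ord0 /= cos0 sin0 cos_pihalf sin_pihalf => e0 e1 d0.
have -> : c 0%N = 1 by lra.
have -> : c 1%N = 0 by lra.
have -> : c 2%N = -1 by lra.
have -> : 2 * t = t + t by ring.
rewrite cosD subn0 subSS subn0 subnn; ring.
Qed.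

(** In degrees 3 and 6 the linear systems become rational once the coefficients
   of odd index are multiplied by [cos (pi / 6)]. *)
Lemma extremal_form3 c : (forall t, -1 <= form 3 c (cos t) (sin t) <= 1) ->
  form 3 c (cos 0) (sin 0) = 1 -> form 3 c (cos (pi / 3)) (sin (pi / 3)) = -1 ->
  forall t, form 3 c (cos t) (sin t) = cos (3 * t).
Proof.
move=> b e0 e1 t; have := form_extremum b (or_introl e0).
have := form_extremum b (or_intror e1); move: e0 e1.
rewrite /form !big_ord_recr !big_ord0 /= cos0 sin0 cos_pi3 sin_pi3.
rewrite !(subSS, subn0) /= !(expr0, expr1) => e0 e1 d1 d0.
have s0 := cos_pi6_gt0; have s2 := cos2_pi6.
set s := cos _ in s0 s2 e1 d1.
have s3 : s ^+ 3 = 3 / 4 * s by rewrite exprS s2 mulrC.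
have C0 : c 0%N = 1 by lra.
have C1 : c 1%N = 0 by lra.
rewrite s2 s3 C0 C1 in e1.
have {}d1 : (- (3 / 4) - c 2 / 4) * s ^+ 2 + 9 / 8 * (c 3 * s) = 0.
  have s3c : c 2 * s ^+ 3 = 3 / 4 * (c 2 * s) by rewrite s3; ring.
  have s2c : c 3 * s ^+ 2 = 3 / 4 * c 3 by rewrite s2; ring.
  have h : (- (3 / 4) - c 2 / 4) * s + 9 / 8 * c 3 = 0 by rewrite C0 C1 in d1; lra.
  by rewrite -(mul0r s) -h; ring.
have [C2 C3] : c 2 = -3 /\ c 3 = 0.
  have : c 3 * s = 0 by rewrite s2 in d1; lra.
  by move=> h; split; [lra|apply: (mulIf (lt0r_neq0 s0)); lra].
rewrite C0 C1 C2 C3.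
have -> : 3 * t = t + t + t by ring.
rewrite !(cosD, sinD); ring.
Qed.

Lemma extremal_form4 c : (forall t, -1 <= form 4 c (cos t) (sin t) <= 1) ->
  form 4 c (cos 0) (sin 0) = 1 -> form 4 c (cos (pi / 4)) (sin (pi / 4)) = -1 ->
  forall t, form 4 c (cos t) (sin t) = cos (4 * t).
Proof.
move=> b e0 e1 t; have := form_extremum b (or_introl e0).
have := form_extremum b (or_intror e1); move: e0 e1.
have := b (pi / 2); have := b (pi / 2 + pi / 4).
rewrite /form !big_ord_recr !big_ord0 /= cos0 sin0 cosD sinD cos_pihalf sin_pihalf.
rewrite sin_pi4 !(subSS, subn0) /= !(expr0, expr1).
have s2 := cos2_pi4; have s0 := cos_pi4_gt0; set s := cos _ in s0 s2 *.
have s4 : s ^+ 4 = 1 / 4 by rewrite (exprM s 2 2) s2; field.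
move=> b3 b2 e0 e1 d1 d0.
have C0 : c 0%N = 1 by lra.
have C1 : c 1%N = 0 by lra.
have E1 : 1 + c 2 + c 3 + c 4 = -4.
  have : (c 0%N + c 1%N + c 2 + c 3 + c 4) * s ^+ 4 = -1 by rewrite -e1; ring.
  by rewrite s4 C0 C1; lra.
have E2 : c 3 + 2 * c 4 = 2.
  have : (- 4 * c 0%N + - 2 * c 1%N + 2 * c 3 + 4 * c 4) * s ^+ 4 = 0 by rewrite -d1; ring.
  by rewrite s4 C0 C1; lra.
have C4le : c 4 <= 1 by lra.
have C3le : c 3 <= 0.
  have : -1 <= (c 0%N - c 1%N + c 2 - c 3 + c 4) * s ^+ 4.
    have /andP[h _] := b3; apply: le_trans h _; rewrite le_eqVlt; apply/orP; left.
    by apply/eqP; ring.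
  by rewrite s4 C0 C1; lra.
have -> : c 0%N = 1 by [].
have -> : c 1%N = 0 by [].
have -> : c 2 = -6 by lra.
have -> : c 3 = 0 by lra.
have -> : c 4 = 1 by lra.
have -> : 4 * t = (t + t) + (t + t) by ring.
rewrite !(cosD, sinD); ring.
Qed.

Lemma extremal_form6 c : (forall t, -1 <= form 6 c (cos t) (sin t) <= 1) ->
  form 6 c (cos 0) (sin 0) = 1 -> form 6 c (cos (pi / 6)) (sin (pi / 6)) = -1 ->
  forall t, form 6 c (cos t) (sin t) = cos (6 * t).
Proof.
move=> b e0 e1 t; have := form_extremum b (or_introl e0).
have := form_extremum b (or_intror e1); move: e0 e1.
have := b (pi / 3); have := b (pi / 2).
have := b (pi / 2 + pi / 6); have := b (pi / 2 + pi / 3).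
rewrite /form !big_ord_recr !big_ord0 /= cos0 sin0 !cosD !sinD cos_pihalf sin_pihalf.
rewrite cos_pi3 sin_pi3 sin_pi6 !(subSS, subn0) /= !(expr0, expr1).
have s2 := cos2_pi6; have s0 := cos_pi6_gt0; set s := cos _ in s0 s2 *.
move=> b5 b4 b3 b2 e0 e1 d1 d0.
have s4 : s ^+ 4 = 9 / 16 by rewrite (exprM s 2 2) s2; field.
have s6 : s ^+ 6 = 27 / 64 by rewrite (exprM s 2 3) s2; field.
have s3 : s ^+ 3 = 3 / 4 * s by rewrite exprSr s2.
have s5 : s ^+ 5 = 9 / 16 * s by rewrite exprSr s4.
have C0 : c 0%N = 1 by lra.
have C1 : c 1%N = 0 by lra.
have K2 x : x * s ^+ 2 = 3 / 4 * x by rewrite s2 mulrC.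
have K3 x : x * s ^+ 3 = 3 / 4 * (x * s) by rewrite s3; ring.
have K4 x : x * s ^+ 4 = 9 / 16 * x by rewrite s4 mulrC.
have K5 x : x * s ^+ 5 = 9 / 16 * (x * s) by rewrite s5; ring.
have K6 x : x * s ^+ 6 = 27 / 64 * x by rewrite s6 mulrC.
have E1 : 27 + 9 * c 2 + 6 * (c 3 * s) + 3 * c 4 + 2 * (c 5 * s) + c 6 = -64.
  have := K4 (c 2); have := K3 (c 3); have := K2 (c 4); rewrite C0 C1 in e1; lra.
have D1 : - 81 + 9 * c 2 + 18 * (c 3 * s) + 15 * c 4 + 14 * (c 5 * s) + 9 * c 6 = 0.
  have h : (- 81 + 9 * c 2 + 15 * c 4 + 9 * c 6) * s
      + 3 / 4 * (18 * c 3 + 14 * c 5) = 0.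
    have := K3 (c 2); have := K5 (c 2); have := K2 (c 3); have := K4 (c 3).
    have := K3 (c 4); have := K2 (c 5); rewrite C0 C1 in d1; lra.
  have : ((- 81 + 9 * c 2 + 15 * c 4 + 9 * c 6) * s
      + 3 / 4 * (18 * c 3 + 14 * c 5)) * s = 0 by rewrite h mul0r.
  by rewrite mulrDl -mulrA -expr2 s2; lra.
have [B2 B4] : 1 + 3 * c 2 + 6 * (c 3 * s) + 9 * c 4 + 18 * (c 5 * s) + 27 * c 6 <= 64
  /\ 1 + 3 * c 2 - 6 * (c 3 * s) + 9 * c 4 - 18 * (c 5 * s) + 27 * c 6 <= 64.
  have := K2 (c 2); have := K3 (c 3); have := K4 (c 4); have := K5 (c 5).
  by have := K6 (c 6); rewrite C0 C1 in b2 b4; lra.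
have B5 : -64 <= 27 + 9 * c 2 - 6 * (c 3 * s) + 3 * c 4 - 2 * (c 5 * s) + c 6.
  have := K4 (c 2); have := K3 (c 3); have := K2 (c 4); rewrite C0 C1 in b5; lra.
have B3 : -1 <= c 6 by lra.
clear b b2 b3 b4 b5 e0 e1 d1 d0 K2 K3 K4 K5 K6.
have C3 : c 3 = 0 by apply: (mulIf (lt0r_neq0 s0)); lra.
have C5 : c 5 = 0 by apply: (mulIf (lt0r_neq0 s0)); lra.
have C2 : c 2 = -15 by lra.
have C4 : c 4 = 15 by lra.
have C6 : c 6 = -1 by lra.
rewrite C0 C1 C2 C3 C4 C5 C6.
have -> : 6 * t = (t + t) + (t + t) + (t + t) by ring.
rewrite !(cosD, sinD); ring.
Qed.

(** The bounds at the angles [k pi / d], with the values and the vanishing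
   derivatives at both ends of the arc, are linear conditions on the coefficients
   that only the coefficients of [cos (d t)] satisfy. *)
Lemma extremal_form d c : (d \in [:: 1; 2; 3; 4; 6])%N ->
  (forall t, -1 <= form d c (cos t) (sin t) <= 1) ->
  form d c (cos 0) (sin 0) = 1 -> form d c (cos (pi / d%:R)) (sin (pi / d%:R)) = -1 ->
  forall t, form d c (cos t) (sin t) = cos (d%:R * t).
Proof.
rewrite !inE => /or4P[||| /orP[]] /eqP -> b e0 e1 t.
- by rewrite mul1r; exact: extremal_form1.
- exact: extremal_form2.
- exact: extremal_form3.
- exact: extremal_form4.
- exact: extremal_form6.
Qed.

End ExtremalForms.

(** * Great circles *)

Section SphericalGeometry.
Variable R : realType.

Lemma le_cos (a b : R) : 0 <= a -> a <= b -> b <= pi -> cos b <= cos a.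
Proof.
move=> a0 ab bpi.
have ai : a \in `[0, pi] by rewrite in_itv /=; lra.
have bi : b \in `[0, pi] by rewrite in_itv /=; lra.
by rewrite leNgt (ltr_cos bi ai) -leNgt.
Qed.

Lemma cos_le (a b : R) : 0 <= a <= pi -> 0 <= b <= pi -> cos b <= cos a -> a <= b.
Proof.
move=> ha hb; have ai : a \in `[0, pi] by rewrite in_itv.
have bi : b \in `[0, pi] by rewrite in_itv.
by rewrite leNgt (ltr_cos bi ai) -leNgt.
Qed.

Variable n : nat.
Implicit Types (x y z v : 'rV[R]_n).

Lemma sphere_cos_acos x y : sphere x -> sphere y -> cos (acos (dotv x y)) = dotv x y.
Proof. by move=> sx sy; rewrite acosK // in_itv /= dotv_le1. Qed.

Lemma acos_itv x y : sphere x -> sphere y -> 0 <= acos (dotv x y) <= pi.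
Proof. by move=> sx sy; rewrite acos_ge0 ?acos_lepi // dotv_le1. Qed.

(** The Cauchy-Schwarz inequality for the components of [x] and [z] orthogonal to
   [y]. *)
Lemma spherical_triangle x y z (a b : R) : sphere x -> sphere y -> sphere z ->
  0 <= a <= pi -> 0 <= b <= pi -> dotv x y = cos a -> dotv y z = cos b ->
  cos (a + b) <= dotv x z.
Proof.
move=> /sphere_dotv x1 /sphere_dotv y1 /sphere_dotv z1 ha hb xy yz.
have := cauchy_schwarz (x + (- cos a) *: y) (z + (- cos b) *: y).
rewrite !(dotvDl, dotvDr, dotvZl, dotvZr) (dotvC y x) (dotvC z y) x1 y1 z1 xy yz.
have sa := sin_ge0_pi ha; have sb := sin_ge0_pi hb.
have ca := cos2Dsin2 a; have cb := cos2Dsin2 b.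
rewrite cosD; set ka := cos a in ca *; set kb := cos b in cb *.
set u := dotv x z => h.
have {}h : (u - ka * kb) ^+ 2 <= (sin a * sin b) ^+ 2.
  rewrite exprMn; have -> : sin a ^+ 2 = 1 - ka ^+ 2 by rewrite -ca; ring.
  have -> : sin b ^+ 2 = 1 - kb ^+ 2 by rewrite -cb; ring.
  apply: le_trans (le_trans _ h) _; rewrite le_eqVlt; apply/orP; left;
  by apply/eqP; ring.
have : `|u - ka * kb| <= sin a * sin b.
  rewrite -(@ler_pXn2r _ 2) ?nnegrE ?mulr_ge0 //.
  by rewrite real_normK ?num_real.
rewrite ler_norml => /andP[]; lra.
Qed.

Definition great_circle (y v : 'rV[R]_n) (t : R) : 'rV[R]_n := cos t *: y + sin t *: v.

Lemma circle_dotv y v s t : sphere y -> sphere v -> dotv y v = 0 ->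
  dotv (great_circle y v s) (great_circle y v t) = cos (s - t).
Proof.
move=> /sphere_dotv y1 /sphere_dotv v1 yv.
rewrite !(dotvDl, dotvDr, dotvZl, dotvZr) (dotvC v y) yv y1 v1 cosB; ring.
Qed.

Lemma sphere_circle y v t : sphere y -> sphere v -> dotv y v = 0 ->
  sphere (great_circle y v t).
Proof.
by move=> sy sv yv; apply: dotv_sphere; rewrite circle_dotv // subrr cos0.
Qed.

Lemma circle0 y v : great_circle y v 0 = y.
Proof. by rewrite /great_circle cos0 sin0 scale1r scale0r addr0. Qed.

Lemma exists_orthogonal y : (1 < n)%N -> exists2 v, sphere v & dotv y v = 0.
Proof.
move=> n1; pose i := Ordinal (ltnW n1); pose j := Ordinal n1.
have ij : i != j by [].
have [v v0 yv] : exists2 v, v != 0 & dotv y v = 0.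
  have dE k : dotv y (ebase k) = y 0 k.
    rewrite /dotv (bigD1 k) //= mxE !eqxx mulr1 big1 ?addr0 // => l lk.
    by rewrite mxE eqxx /= (negbTE lk) mulr0.
  have [yj|yj] := eqVneq (y 0 j) 0.
    exists (ebase j); last by rewrite dE.
    apply/eqP => /rowP/(_ j); rewrite !mxE !eqxx => /eqP.
    by rewrite oner_eq0.
  exists (y 0 j *: ebase i + (- y 0 i) *: ebase j).
    apply/eqP => /rowP/(_ i); rewrite !mxE !eqxx /= mulr1 mulr0 addr0.
    by apply/eqP.
  by rewrite dotvDr !dotvZr !dE; ring.
exists ((enorm v)^-1 *: v); first exact: sphere_normalize.
by rewrite dotvZr yv mulr0.
Qed.

(** Antipodal points, at distance [a = pi], lie on many great circles; any
   direction orthogonal to [y] will do. *)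
Lemma exists_circle x y (a : R) : (1 < n)%N -> sphere x -> sphere y ->
  0 < a <= pi -> dotv x y = cos a ->
  exists v, [/\ sphere v, dotv y v = 0 & x = great_circle y v a].
Proof.
move=> n1 sx sy /andP[a0 api] xy.
have x1 := sphere_dotv sx; have y1 := sphere_dotv sy.
have [E|api'] := eqVneq a pi.
  rewrite E cospi in xy *; have [v sv yv] := exists_orthogonal y n1.
  exists v; split => //; rewrite /great_circle cospi sinpi scale0r addr0 scaleN1r.
  apply/eqP; rewrite -addr_eq0 -dotv_eq0 !(dotvDl, dotvDr) (dotvC y x) x1 y1 xy.
  by apply/eqP; ring.
have sa : 0 < sin a by rewrite sin_gt0_pi // a0 lt_neqAle api' api.
exists ((sin a)^-1 *: (x + (- cos a) *: y)); split.
- apply: dotv_sphere.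
  rewrite !(dotvDl, dotvDr, dotvZl, dotvZr) (dotvC y x) x1 y1 xy.
  have := cos2Dsin2 a => cs.
  transitivity ((1 - cos a ^+ 2) / sin a ^+ 2); first by field; rewrite gt_eqF.
  by rewrite -cs addrAC subrr add0r divff // gt_eqF // exprn_gt0.
- rewrite !(dotvDl, dotvDr, dotvZl, dotvZr) (dotvC y x) y1 xy; ring.
- rewrite /great_circle scalerA mulfV ?gt_eqF // scale1r scaleNr.
  by rewrite addrCA subrr addr0.
Qed.

End SphericalGeometry.

(** * The angle function of an isoparametric foliation *)

(** The properties of the angle that the analysis uses. The last one is that a
   great circle through [x] meets every leaf at the distance prescribed by the
   angles. It is restricted to positive angles, as the gradient of a profile is
   radial at angle 0. *)
Record isoparametric_angle (R : realType) (n d : nat)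
    (q theta : 'rV[R]_n -> R) : Prop := IsoparametricAngle {
  angle_smooth : smooth_on [set x | x != 0] (ray_ext q);
  angle_itv : forall x, sphere x -> 0 <= theta x <= pi / d%:R;
  angle_cos : forall x, sphere x -> q x = cos (d%:R * theta x);
  angle_lipschitz : forall x z, sphere x -> sphere z ->
    dotv x z <= cos (theta x - theta z);
  angle_segment : forall x s, sphere x -> 0 < theta x -> 0 <= s <= pi / d%:R ->
    exists z, [/\ sphere z, theta z = s & dotv x z = cos (theta x - s)]
}.

Section DistanceToCompact.
Variables (R : realType) (n : nat).
Implicit Types (x y : 'rV[R]_n) (A : set 'rV[R]_n).

(** The distance is handled through its cosine, which is the maximum over [A] of
   a linear function. *)
Lemma sdist_attained A x : A !=set0 -> compact A -> A `<=` sphere -> sphere x ->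
  (exists2 y, A y & dotv x y = cos (sdist x A)) /\
  (forall y, A y -> dotv x y <= cos (sdist x A)).
Proof.
move=> A0 cA As sx.
have [y0 /set_mem Ay0 ymax] : exists2 c, c \in A & forall t, t \in A -> dotv x t <= dotv x c.
  apply: EVT_max_rV => //; apply: continuous_subspaceT => y.
  have := @continuous_dotv_alg R n x y.
  rewrite (_ : (fun z => dotv z x) = dotv x) //.
  by apply/funext => z; rewrite dotvC.
have sy0 := As _ Ay0.
have le_acos y : A y -> acos (dotv x y0) <= acos (dotv x y).
  move=> Ay; have sy := As _ Ay.
  apply: cos_le; rewrite ?acos_itv // !sphere_cos_acos //.
  by apply: ymax; exact: mem_set.
have E : sdist x A = acos (dotv x y0).
  apply/eqP; rewrite eq_le; apply/andP; split.
    apply: ge_inf; last by exists y0.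
    by exists (acos (dotv x y0)) => _ [y Ay <-]; exact: le_acos.
  apply: lb_le_inf; first by exists (acos (dotv x y0)), y0.
  by move=> _ [y Ay <-]; exact: le_acos.
rewrite E sphere_cos_acos //; split; first by exists y0.
by move=> y Ay; apply: ymax; exact: mem_set.
Qed.

(** The spherical triangle inequality, through the point of [A] nearest to the
   one of [x] and [z] that is closer to [A]. *)
Lemma sdist_lipschitz A x z : A !=set0 -> compact A -> A `<=` sphere ->
  sphere x -> sphere z -> 0 <= sdist x A <= pi -> 0 <= sdist z A <= pi ->
  dotv x z <= cos (sdist x A - sdist z A).
Proof.
move=> A0 cA As.
have main u w : sphere u -> sphere w -> 0 <= sdist u A <= pi ->
    0 <= sdist w A <= pi -> sdist w A <= sdist u A ->
    dotv u w <= cos (sdist u A - sdist w A).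
  move=> su sw hu hw wu; have [[k Ak wk] _] := sdist_attained A0 cA As sw.
  have [_ /(_ k Ak) uk] := sdist_attained A0 cA As su.
  rewrite leNgt; apply/negP => lt.
  have ha := acos_itv su sw.
  have ea := sphere_cos_acos su sw.
  rewrite -ea in lt.
  set a := acos _ in ha ea lt.
  have lta : a < sdist u A - sdist w A.
    rewrite ltNge; apply/negP => h; move: lt; rewrite ltNge => /negP; apply.
    by apply: le_cos; lra.
  have h1 := spherical_triangle su sw (As _ Ak) ha hw (esym ea) wk.
  have : cos (a + sdist w A) <= cos (sdist u A) by exact: le_trans uk.
  move=> /cos_le h2.
  have : sdist u A <= a + sdist w A by apply: h2; lra.
  lra.
move=> sx sz hx hz; have [zx|xz] := leP (sdist z A) (sdist x A); first exact: main.
rewrite dotvC -cosN opprB; apply: main => //; exact: ltW.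
Qed.

End DistanceToCompact.

Section Foliation.
Variables (R : realType) (n d : nat) (M : R -> set 'rV[R]_n).

Lemma alg_meval (P : mpoly.mpoly n R) :
  alg (fun g : 'rV[R]_n -> R => exists j, g = (fun y => y 0 j))
    (fun x => mpoly.meval (fun i => x 0 i) P).
Proof.
apply: (@alg_ext _ _ _ (fun x : 'rV[R]_n => \sum_(m <- mpoly.msupp P)
   mpoly.mcoeff m P * \prod_i x 0 i ^+ m i)).
  by move=> x; rewrite mpoly.mevalE.
apply: alg_bigsum => m; apply: alg_mul; first exact: alg_cst.
elim: (index_enum _) => [|i r IH].
  by apply: (@alg_ext _ _ _ (fun=> 1)) (alg_cst _ _) => x; rewrite big_nil.
apply: (@alg_ext _ _ _ (fun x : 'rV[R]_n => x 0 i ^+ m i * \prod_(j <- r) x 0 j ^+ m j)).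
  by move=> x; rewrite big_cons.
by apply: alg_mul => //; apply: alg_exp; apply: alg_base; exists i.
Qed.

Lemma compact_level (p : 'rV[R]_n -> R) (s : R) : continuous p -> compact (level p s).
Proof.
move=> cp; apply: bounded_closed_compact.
  exists 1; split; first exact: num_real.
  move=> b b1 x [sx _]; apply: le_trans (ltW b1).
  rewrite [leLHS]/Num.Def.normr /= mx_normrE; apply: bigmax_le => // -[i j] _ /=.
  rewrite (ord1 i) -(@ler_pXn2r _ 2) ?nnegrE // expr1n real_normK ?num_real //.
  rewrite -(sphere_dotv sx) /dotv (bigD1 j) //= -expr2 lerDl.
  by apply: sumr_ge0 => k _; rewrite -expr2 sqr_ge0.
have -> : level p s = @enorm R n @^-1` [set 1] `&` p @^-1` [set s] by [].
apply: closedI; apply: preimage_closed => [x _|]; try exact: closed_eq.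
- exact: continuous_enorm.
- exact: cp.
Qed.

Hypothesis n1 : (1 < n)%N.
Hypothesis foliation : isoparametric_foliation d M.
Let T : R := pi / d%:R.
Let theta x := sdist x (M 0).

Lemma foliation_deg : (0 < d)%N.
Proof. by have [+ _] := foliation; rewrite !inE => /or4P[||| /orP[]] /eqP ->. Qed.

Lemma foliation_itv : 0 < T <= pi.
Proof.
have d0 : 0 < d%:R :> R by rewrite ltr0n foliation_deg.
rewrite divr_gt0 ?pi_gt0 //= ler_pdivrMr // ler_peMr ?pi_ge0 //.
by rewrite ler1n foliation_deg.
Qed.

(** The leaves are the level sets of [p], and the distance to [M 0] tells them
   apart: [p] and [theta] have the same fibres. *)
Lemma foliation_leaf : exists p, [/\
  forall t x, 0 <= t <= T -> M t x -> sphere x /\ theta x = t,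
  forall x, sphere x -> 0 <= theta x <= T /\ M (theta x) x &
  forall x z, sphere x -> sphere z -> (p x = p z <-> theta x = theta z)] /\
  [/\ smooth_on [set x | x != 0] (ray_ext p), forall x, sphere x -> -1 <= p x <= 1,
   continuous p, (forall y v, is_form d (fun a b => p (a *: y + b *: v))) &
   exists2 e : R, e = 1 \/ e = -1 & [/\ M 0 = level p e, M T = level p (- e),
      M 0 !=set0 & M T !=set0]].
Proof.
have [_ [P]] := foliation; set p := (fun x => _) => /= -[[hP isoP pb pcrit _] [fM M0T hdist]].
exists p.
have leafE t x : 0 <= t <= T -> M t x -> sphere x /\ theta x = t.
  move=> ht Mx; split; last exact: hdist.
  have : [set M t | t in `[0, pi / d%:R]] (M t) by exists t; rewrite //= in_itv.
  by rewrite fM => -[_ [y sy <-] E]; move: Mx; rewrite -E => -[].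
have level_leaf x : sphere x -> exists2 t, 0 <= t <= T & M t = level p (p x).
  move=> sx; have : [set level p s | s in p @` sphere] (level p (p x)).
    by exists (p x) => //; exists x.
  by rewrite -fM => -[t]; rewrite /= in_itv /= => ht E; exists t.
have leaf x : sphere x -> 0 <= theta x <= T /\ M (theta x) x.
  move=> sx; have [t ht E] := level_leaf x sx.
  have Mx : M t x by rewrite E.
  by have [_ ->] := leafE _ _ ht Mx.
split; split => //.
- move=> x z sx sz; split => E.
    have [t ht Et] := level_leaf x sx.
    have [|_ ->] := leafE t x ht; first by rewrite Et.
    by have [|_ ->] := leafE t z ht; first by rewrite Et.
  have [t ht Et] := level_leaf x sx.
  have [|_ tx] := leafE t x ht; first by rewrite Et.
  have [_] := leaf z sz; rewrite -E tx Et => -[_ ->] //.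
- by have [] := isoP.
- by apply: continuous_coord_alg; exact: alg_meval.
- by move=> y v; exact: is_form_plane.
have ne (s : R) : s = 1 \/ s = -1 -> level p s !=set0.
  move=> s1; have : [set -1; 1] s by case: s1 => ->; [right|left].
  by rewrite -pcrit => -[x [sx _] <-]; exists x.
by case: M0T => -[E1 E2]; [exists 1; first by left|exists (-1); first by right];
  rewrite ?opprK /T E1 E2; split => //; apply: ne; tauto.
Qed.

(** A great circle from [M 0] to [M T] shows that the polynomial is
   [cos (d theta)]: [extremal_form] applies on it, and it meets all leaves. The
   same form then lives on the minimal great circle to any point [x], first on
   an arc and so everywhere, and reading [theta] from it shows that this great
   circle meets all leaves at the right place. *)
Lemma foliation_angle : exists2 q, isoparametric_angle d q theta &
  exists y v, [/\ sphere y, sphere v, dotv y v = 0,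
    forall t, q (great_circle y v t) = cos (d%:R * t) &
    forall t, 0 <= t <= T -> theta (great_circle y v t) = t].
Proof.
have [T0 Tpi] := andP foliation_itv.
have [p [[leafE leaf pE] [sp pb cp pf [e e1 [M0 MT ne0 neT]]]]] := foliation_leaf.
have M0s : M 0 `<=` sphere by rewrite M0 => x [].
have M0c : compact (M 0) by rewrite M0; exact: compact_level.
have th0 x : sphere x -> 0 <= theta x <= pi.
  by move=> /leaf[/andP[h1 h2] _]; rewrite h1 (le_trans h2).
have lip x z : sphere x -> sphere z -> dotv x z <= cos (theta x - theta z).
  by move=> sx sz; apply: sdist_lipschitz => //; exact: th0.
pose q x := e * p x.
have qb x : sphere x -> -1 <= q x <= 1.
  by move=> /pb; rewrite /q; case: e1 => ->; lra.
have qf y v : is_form d (fun a b => q (a *: y + b *: v)) by exact: is_form_scale.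
(* The distance to [M 0] along a minimal great circle is the arc length. *)
have minimal x : sphere x -> 0 < theta x -> exists y v, [/\ M 0 y, sphere v,
    dotv y v = 0, x = great_circle y v (theta x) &
    forall t, 0 <= t <= theta x -> theta (great_circle y v t) = t].
  move=> sx tx; have [[y My xy] _] := sdist_attained ne0 M0c M0s sx.
  have sy := M0s _ My.
  have [|v [sv yv xE]] := exists_circle n1 sx sy _ xy.
    by rewrite tx /=; have /andP[] := th0 x sx.
  exists y, v; split => // t /andP[t0 t1].
  have st : sphere (great_circle y v t) by exact: sphere_circle.
  have /andP[c0 c1] := th0 _ st; have /andP[x0 x1] := th0 x sx.
  have [_ /(_ y My)] := sdist_attained ne0 M0c M0s st.
  rewrite -[X in dotv _ X](circle0 y v) circle_dotv // subr0 => h1.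
  have le1 : theta (great_circle y v t) <= t by apply: cos_le h1; lra.
  have h2 := lip x (great_circle y v t) sx st.
  rewrite {1}xE circle_dotv // in h2.
  have : theta x - theta (great_circle y v t) <= theta x - t by apply: cos_le h2; lra.
  lra.
have [x0 Mx0] := neT.
have [sx0 tx0] : sphere x0 /\ theta x0 = T by apply: leafE => //; lra.
have [|y0 [v0 [My0 sv0 yv0 xE0 th]]] := minimal x0 sx0; first by rewrite tx0.
rewrite tx0 in xE0 th.
have sy0 := M0s _ My0.
have e2 : e * e = 1 by case: e1 => ->; ring.
have qy0 : q y0 = 1 by move: My0; rewrite M0 => -[_]; rewrite /q => ->.
have qx0 : q x0 = -1 by move: Mx0; rewrite MT => -[_]; rewrite /q => ->; rewrite mulrN e2.
have [c0 cE0] := qf y0 v0.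
have cosE : forall t, form d c0 (cos t) (sin t) = cos (d%:R * t).
  apply: extremal_form.
  - by have [] := foliation.
  - by move=> t; rewrite -cE0; apply: qb; exact: sphere_circle.
  - by rewrite -cE0 -/(great_circle y0 v0 0) circle0.
  - by rewrite -cE0 -/(great_circle y0 v0 _) -xE0.
have qth x : sphere x -> q x = cos (d%:R * theta x).
  move=> sx; have [ht _] := leaf x sx.
  rewrite -cosE -cE0 /q; congr (e * _); apply/pE => //; first exact: sphere_circle.
  by rewrite th.
exists q; last first.
  by exists y0, v0; split => // t; rewrite -cosE -cE0.
split => //.
- apply: smooth_on_algE; first exact: open_neq0.
  by apply: alg_mul; [exact: alg_cst|exact: alg_base].
- by move=> x /leaf[].
move=> x s sx tx hs.
have [y [v [My sv yv xE thx]]] := minimal x sx tx.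
have sy := M0s _ My.
have [c cE] := qf y v.
have formE : forall a b, form d c a b = form d c0 a b.
  apply: (form_arc_eq tx) => t ht; rewrite cosE -cE -/(great_circle y v t) qth ?thx //.
  exact: sphere_circle.
have ss : sphere (great_circle y v s) by exact: sphere_circle.
exists (great_circle y v s); split => //; last by rewrite {1}xE circle_dotv.
have : cos (d%:R * theta (great_circle y v s)) = cos (d%:R * s).
  by rewrite -qth // {1}/great_circle cE formE cosE.
have d0 : 0 < d%:R :> R by rewrite ltr0n foliation_deg.
have inpi u : 0 <= u <= T -> d%:R * u \in `[0, pi].
  move=> /andP[u0 uT]; rewrite in_itv /= mulr_ge0 ?(ltW d0) //=.
  by rewrite mulrC -ler_pdivlMr.
have [ht _] := leaf _ ss.
by move=> /(cos_inj (inpi _ ht) (inpi _ hs)) /(mulfI (lt0r_neq0 d0)).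
Qed.

End Foliation.

(** * Supporting lines and hyperplanes *)

Section PlanarSupport.
Variables (R : realType) (T : R) (G G1 G2 : R -> R).
Hypothesis Tpi : T <= pi.
Hypothesis dG : forall t : R, 0 <= t <= T -> is_derive t 1 G (G1 t).
Hypothesis dG1 : forall t : R, 0 <= t <= T -> is_derive t 1 G1 (G2 t).
Hypothesis convex : forall t : R, 0 <= t <= T -> 0 < G2 t + G t.

Lemma MVT_between (f df : R -> R) (a b : R) : a < b -> 0 <= a -> b <= T ->
  (forall t : R, 0 <= t <= T -> is_derive t 1 f (df t)) ->
  exists2 s, a < s < b & f b - f a = df s * (b - a).
Proof.
move=> ab a0 bT d.
have [||s sab ->] := @MVT _ f df a b ab.
- by move=> s; rewrite in_itv /= => /andP[? ?]; apply: d; lra.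
- apply: continuous_in_subspaceT => s; rewrite inE /= in_itv /= => /andP[? ?].
  have /d/is_derive_cont// : 0 <= s <= T by lra.
by exists s.
Qed.

(** The difference [D] of both sides satisfies [D'' + D > 0] and vanishes to
   second order at [t0]. The derivative in [s] of
   [D' s * sin (t - s) + D s * cos (t - s)] is [(D'' + D) s * sin (t - s)], which
   has the sign of [t - s]; this function goes from 0 at [t0] to [D t] at [t]. *)
Lemma support_line (t0 t : R) : 0 <= t0 <= T -> 0 <= t <= T ->
  G t0 * cos (t - t0) + G1 t0 * sin (t - t0) <= G t.
Proof.
move=> h0 ht.
pose D s := G s - (G t0 * cos (s - t0) + G1 t0 * sin (s - t0)).
pose D1 s := G1 s - (G t0 * - sin (s - t0) + G1 t0 * cos (s - t0)).
pose W s := D1 s * sin (t - s) + D s * cos (t - s).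
have dl (s : R) : is_derive s 1 (fun s => s - t0) 1.
  have := is_derive_sub (is_derive_id s 1) (is_derive_cstf s 1 t0).
  by rewrite subr0.
have dr (s : R) : is_derive s 1 (fun s => t - s) (-1).
  have := is_derive_sub (is_derive_cstf s 1 t) (is_derive_id s 1).
  by rewrite sub0r.
have dc (s : R) : is_derive s 1 (fun s => cos (s - t0)) (- sin (s - t0)).
  by have := is_derive_compV (f := fun s => s - t0) (is_derive_cos (s - t0)) (dl s); rewrite mulr1.
have ds (s : R) : is_derive s 1 (fun s => sin (s - t0)) (cos (s - t0)).
  by have := is_derive_compV (f := fun s => s - t0) (is_derive_sin (s - t0)) (dl s); rewrite mulr1.
have dW (s : R) : 0 <= s <= T -> is_derive s 1 W ((G2 s + G s) * sin (t - s)).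
  move=> hs.
  have dD : is_derive s 1 D (D1 s).
    apply: is_derive_eq (is_derive_sub (dG hs) (is_derive_add
      (is_derive_mul (is_derive_cstf s 1 (G t0)) (dc s))
      (is_derive_mul (is_derive_cstf s 1 (G1 t0)) (ds s)))) _.
    by rewrite !mul0r !add0r.
  have dD1 : is_derive s 1 D1 (G2 s + (G s - D s)).
    apply: is_derive_eq (is_derive_sub (dG1 hs) (is_derive_add
      (is_derive_mul (is_derive_cstf s 1 (G t0)) (is_derive_opp (ds s)))
      (is_derive_mul (is_derive_cstf s 1 (G1 t0)) (dc s)))) _.
    by rewrite !mul0r !add0r /D; ring.
  apply: is_derive_eq (is_derive_add
    (is_derive_mul dD1 (is_derive_compV (f := fun s => t - s) (is_derive_sin (t - s)) (dr s)))
    (is_derive_mul dD (is_derive_compV (f := fun s => t - s) (is_derive_cos (t - s)) (dr s)))) _.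
  ring.
have W0 : W t0 = 0 by rewrite /W /D1 /D subrr sin0 cos0; ring.
have Wt : W t = D t by rewrite /W subrr sin0 cos0; ring.
suff : 0 <= D t by rewrite subr_ge0.
rewrite -Wt; have [lt|lt|e] := ltgtP t0 t; last by rewrite -e W0.
- have [||s /andP[s1 s2] E] := MVT_between lt _ _ dW; [lra|lra|].
  rewrite W0 in E.
  have -> : W t = (G2 s + G s) * sin (t - s) * (t - t0) by rewrite -E subr0.
  rewrite !mulr_ge0 //; try lra.
    by apply/ltW/convex; lra.
  by apply: sin_ge0_pi; have := Tpi; lra.
- have [||s /andP[s1 s2] E] := MVT_between lt _ _ dW; [lra|lra|].
  rewrite W0 in E.
  have -> : W t = (G2 s + G s) * sin (s - t) * (t0 - t).
    by rewrite -[W t]opprK -[- W t]sub0r E -opprB sinN; ring.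
  rewrite !mulr_ge0 //; try lra.
    by apply/ltW/convex; lra.
  by apply: sin_ge0_pi; have := Tpi; lra.
Qed.

Hypothesis G0 : forall t : R, 0 <= t <= T -> 0 < G t.
Hypotheses (G10 : G1 0 = 0) (G1T : G1 T = 0).

(** The polar angle of the gradient of [r * G] at the polar angle [t]. *)
Definition gradient_angle (t : R) : R := t + atan (G1 t / G t).

(** The angle increases, again because [G2 + G] is positive, and it fixes the ends
   of the chamber, where the gradient is radial. *)
Lemma gradient_angle_itv t : 0 <= t <= T -> 0 <= gradient_angle t <= T.
Proof.
pose dA s := 1 + (1 + (G1 s / G s) ^+ 2)^-1 *
   (G2 s * (G s)^-1 + G1 s * (- (G s) ^- 2 * G1 s)).
have d (s : R) : 0 <= s <= T -> is_derive s 1 gradient_angle (dA s).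
  move=> hs; have g0 : G s != 0 by rewrite gt_eqF // G0.
  exact: is_derive_add (is_derive_id s 1) (is_derive_compV (f := fun s => G1 s / G s)
    (is_derive1_atan (G1 s / G s)) (is_derive_mul (dG1 hs) (is_derive_inv g0 (dG hs)))).
have dA0 s : 0 <= s <= T -> 0 < dA s.
  move=> hs; have g0 := G0 hs; have cv := convex hs.
  have p0 : 0 < G s ^+ 2 + G1 s ^+ 2 by rewrite ltr_wpDr ?sqr_ge0 // exprn_gt0.
  have -> : dA s = G s * (G2 s + G s) / (G s ^+ 2 + G1 s ^+ 2).
    rewrite /dA; field; rewrite !gt_eqF //.
  by rewrite divr_gt0 // mulr_gt0.
move=> /andP[t0 tT].
have A0 : gradient_angle 0 = 0 by rewrite /gradient_angle G10 mul0r atan0 addr0.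
have AT : gradient_angle T = T by rewrite /gradient_angle G1T mul0r atan0 addr0.
apply/andP; split.
  move: t0; rewrite le_eqVlt => /orP[/eqP <-|t0]; first by rewrite A0.
  have [||s /andP[s1 s2] E] := MVT_between t0 _ _ d; [lra|lra|].
  rewrite A0 in E.
  rewrite -[gradient_angle t]subr0 E subr0 mulr_ge0 //; last exact: ltW.
  by apply/ltW/dA0; lra.
move: tT; rewrite le_eqVlt => /orP[/eqP ->|tT]; first by rewrite AT.
have [||s /andP[s1 s2] E] := MVT_between tT _ _ d; [lra|lra|].
  rewrite AT in E.
rewrite -subr_ge0 E mulr_ge0 ?subr_ge0 ?(ltW tT) //.
by apply/ltW/dA0; lra.
Qed.

Lemma gradient_polar t : 0 <= t <= T -> exists2 rho, 0 < rho &
  forall u, G t * cos u + G1 t * sin u = rho * cos (u - (gradient_angle t - t)).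
Proof.
move=> ht; have g0 := G0 ht; pose a := atan (G1 t / G t).
have ca : 0 < cos a by rewrite cos_gt0_pihalf // atan_gtNpi2 atan_ltpi2.
have sa : sin a = G1 t / G t * cos a.
  by rewrite -[LHS](divfK (lt0r_neq0 ca)) -/(tan _) atanK.
exists (G t / cos a); first by rewrite divr_gt0.
move=> u; rewrite /gradient_angle addrAC subrr add0r -/a cosB sa.
by field; rewrite !gt_eqF.
Qed.

Section Support.
Variables (n d : nat) (q theta : 'rV[R]_n -> R).
Hypothesis angle : isoparametric_angle d q theta.
Hypothesis TE : T = pi / d%:R.

(** The planar gradient at [x], placed in the plane of a great circle through [x]
   that meets all leaves, has a known angle, since it lies in the chamber. Angles
   are 1-Lipschitz, so the planar inequality [support_line] bounds the
   scalar products with all other vectors. *)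
Lemma support_hyperplane x : x != 0 -> exists2 z,
  dotv x z = enorm x * G (theta ((enorm x)^-1 *: x)) &
  forall y, y != 0 -> dotv y z <= enorm y * G (theta ((enorm y)^-1 *: y)).
Proof.
move=> x0; set u := _ *: x; have su : sphere u by exact: sphere_normalize.
have hu := angle_itv angle su; rewrite -TE in hu.
have [rho rho0 polar] := gradient_polar hu.
set s := gradient_angle (theta u) in polar.
have hs : 0 <= s <= T by exact: gradient_angle_itv.
have [z [sz zs uz]] : exists z, [/\ sphere z, theta z = s & dotv u z = cos (theta u - s)].
  have [tu|tu] := ltP 0 (theta u).
    by apply: (angle_segment angle su tu); rewrite -TE.
  have t0 : theta u = 0 by apply/eqP; rewrite eq_le tu; have /andP[] := hu.
  have s0 : s = 0 by rewrite /s t0 /gradient_angle G10 mul0r atan0 addr0.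
  by exists u; rewrite s0 t0 subrr cos0 sphere_dotv.
exists (rho *: z).
  rewrite [in LHS](normalizeK x0) dotvZl dotvZr uz; congr (_ * _).
  have := polar 0; rewrite cos0 sin0 mulr1 mulr0 addr0 => ->.
  by congr (_ * cos _); ring.
move=> y y0; rewrite [in leLHS](normalizeK y0); set w := _ *: y.
have sw : sphere w by exact: sphere_normalize.
have hw := angle_itv angle sw; rewrite -TE in hw.
rewrite dotvZl dotvZr ler_wpM2l ?enorm_ge0 //.
apply: le_trans (support_line hu hw).
rewrite polar ler_wpM2l ?(ltW rho0) //.
apply: le_trans (angle_lipschitz angle sw sz) _.
by rewrite zs le_eqVlt; apply/orP; left; apply/eqP; congr cos; ring.
Qed.

End Support.
End PlanarSupport.

(** * Differentiation through the arc cosine *)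

Section CosineComposition.
Variable R : realType.

Lemma acos_continuous_comp (V : topologicalType) (f : V -> R) (x : V) :
  {for x, continuous f} -> (\forall y \near x, -1 <= f y <= 1) ->
  {for x, continuous (fun y => acos (f y))}.
Proof.
have at1 (g : V -> R) : {for x, continuous g} -> (\forall y \near x, -1 <= g y <= 1) ->
    g x = 1 -> {for x, continuous (fun y => acos (g y))}.
  move=> cg bg gx; rewrite /prop_for /continuous_at gx acos1.
  apply/cvgrPdist_lt => e e0.
  pose e' := Num.min e (pi / 2).
  have e'0 : 0 < e' by rewrite lt_min e0 divr_gt0 // pi_gt0.
  have e'pi : e' < pi.
    by rewrite gt_min; apply/orP; right; have := @pi_gt0 R; lra.
  have c1 : 0 < 1 - cos e'.
    rewrite subr_gt0 -cos0 ltr_cos ?in_itv //= ?lexx ?pi_ge0 //.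
    by rewrite !ltW.
  have /cvgrPdist_lt/(_ _ c1) := cg; rewrite gx => h.
  near=> y; rewrite sub0r normrN.
  have by1 : -1 <= g y <= 1 by near: y.
  have gy : `|1 - g y| < 1 - cos e' by near: y.
  have a0 := acos_ge0 by1; rewrite ger0_norm //.
  apply: (@lt_le_trans _ _ e'); last by rewrite ge_min lexx.
  rewrite ltNge; apply/negP => le.
  have := le_cos (ltW e'0) le (acos_lepi by1).
  rewrite acosK ?in_itv //= => h2.
  by move: gy; rewrite ger0_norm; lra.
move=> cf bf; have bx := nbhs_singleton bf.
have [f1|f1] := eqVneq (f x) 1; first exact: at1.
have [fN1|fN1] := eqVneq (f x) (-1).
  have cN : {for x, continuous (fun y => acos (- f y))}.
    apply: at1; first by apply: (@continuousN _ _ _ f x).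
      by apply: filterS bf => y /andP[? ?]; apply/andP; split; lra.
    by rewrite fN1 opprK.
  have c2 : {for x, continuous (fun y => pi - acos (- f y))}.
    by apply: (@cvgB _ _ _ (nbhs x)) => //; exact: cvg_cst.
  apply: near_eq_continuous c2.
  by apply: filterS bf => y hy; rewrite acosN // opprB addrC subrK.
apply: (@continuous_comp _ _ _ f acos) => //; apply: continuous_acos.
move: bx => /andP[b1 b2]; rewrite !lt_neqAle b1 b2 f1 eq_sym fN1 //.
Unshelve. all: by end_near. Qed.

(** By Cauchy's mean value theorem [w b - w a = w1 xi * (cos b - cos a)] for some
   [xi] in between: the values [1] and [-1] of [Q], where [acos] is not
   differentiable, are no exception. *)
Lemma is_derive_acos_comp (w w1 Q : R -> R) (x b : R) :
  (forall t : R, is_derive t 1 w (w1 t * - sin t)) -> continuous w1 ->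
  (forall s, -1 <= Q s <= 1) -> is_derive x 1 Q b ->
  is_derive x 1 (fun s => w (acos (Q s))) (w1 (acos (Q x)) * b).
Proof.
move=> dw cw1 bQ dQ.
pose a s := acos (Q s).
have a0 s : 0 <= a s <= pi by rewrite acos_ge0 // acos_lepi.
have ca s : cos (a s) = Q s by rewrite acosK // in_itv /=.
have cont_w : continuous w by move=> t; exact: is_derive_cont (dw t).
have mv (u v : R) : u < v -> 0 <= u -> v <= pi ->
    exists2 xi, u < xi < v & w v - w u = w1 xi * (cos v - cos u).
  move=> uv u0 vpi.
  have dg0 (t : R) : t \in `]u, v[ -> - sin t != 0.
    rewrite in_itv /= => /andP[t1 t2]; rewrite oppr_eq0 gt_eqF // sin_gt0_pi //.
    by apply/andP; split; lra.
  have [xi hxi E] := cauchy_MVT uv (continuous_subspaceT cont_w)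
    (continuous_subspaceT (@continuous_cos R)) (fun t _ => dw t)
    (fun t _ => is_derive_cos t) dg0.
  exists xi; first by move: hxi; rewrite in_itv.
  have dc := differentiable_subr_neq0 uv (continuous_subspaceT (@continuous_cos R))
    (fun t _ => is_derive_cos t) dg0.
  rewrite mulfK in E; last exact: dg0.
  by rewrite E divfK.
have /boolp.choice[xi hxi] : forall s, exists r, `|r - a x| <= `|a s - a x| /\
    w (a s) - w (a x) = w1 r * (Q s - Q x).
  move=> s; rewrite -!ca; have /andP[s0 spi] := a0 s; have /andP[x0 xpi] := a0 x.
  have [lt|lt|->] := ltgtP (a s) (a x); last by exists (a x); rewrite !subrr mulr0.
  - have [r /andP[r1 r2] E] := mv _ _ lt s0 xpi; exists r; split.
      by rewrite !ler0_norm; lra.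
    by rewrite -[LHS]opprB E; ring.
  - have [r /andP[r1 r2] E] := mv _ _ lt x0 spi; exists r; split => //.
    by rewrite !ger0_norm; lra.
have [k [kE kc kb]] := (is_derive1_caratheodory _ _ _).1 dQ.
apply/is_derive1_caratheodory; exists (fun s => w1 (xi s) * k s).
have xix : xi x = a x.
  have [+ _] := hxi x; rewrite subrr normr0 normr_le0 subr_eq0 => /eqP //.
split.
- by move=> s; have [_] := hxi s; rewrite /a => ->; rewrite kE mulrA.
- apply: (@cvgM _ _ (nbhs x)); last exact: kc.
  apply: (@continuous_comp _ _ _ xi w1); last exact: cw1.
  have ac : {for x, continuous a}.
    apply: acos_continuous_comp; first exact: is_derive_cont dQ.
    by near=> y; exact: bQ.
  apply/cvgrPdist_lt => e e0; have /cvgrPdist_lt/(_ _ e0) := ac.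
  apply: filterS => s; rewrite distrC => h; rewrite xix distrC.
  by apply: le_lt_trans h; have [] := hxi s.
- by rewrite kb xix.
Unshelve. all: by end_near. Qed.

End CosineComposition.

(** * From profiles to Minkowski norms *)

Section ProfileToNorm.
Variables (R : realType) (n d : nat) (q theta : 'rV[R]_n -> R).
Hypothesis d0 : (0 < d)%N.
Hypothesis angle : isoparametric_angle d q theta.
Let T : R := pi / d%:R.
Let U : set 'rV[R]_n := [set x | x != 0].

Lemma ray_ext_itv y : y != 0 -> -1 <= ray_ext q y <= 1.
Proof.
move=> y0; rewrite /ray_ext (angle_cos angle); last exact: sphere_normalize.
by rewrite cos_geN1 cos_le1.
Qed.

Lemma angle_acos x : sphere x -> theta x = d%:R^-1 * acos (q x).
Proof.
move=> sx; have d0' : 0 < d%:R :> R by rewrite ltr0n.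
have /andP[h1 h2] := angle_itv angle sx.
rewrite (angle_cos angle sx) cosK ?mulKf ?gt_eqF // in_itv /=.
by rewrite mulr_ge0 ?(ltW d0') //= mulrC -ler_pdivlMr.
Qed.

(** The derivatives of these functions are products of functions of the same kind
   with derivatives of [ray_ext q]. *)
Lemma smooth_on_profile w : sym_smooth w ->
  smooth_on U (fun x => w (acos (ray_ext q x))).
Proof.
move=> sw; have sq := angle_smooth angle.
pose B (f : 'rV[R]_n -> R) := smooth_on U f \/
  exists2 w, sym_smooth w & f = (fun x => w (acos (ray_ext q x))).
apply: (@smooth_on_alg _ _ _ B (@open_neq0 R n)); last first.
- by apply: alg_base; right; exists w.
- move=> f [sf|[{sw}w sw ->]] i.
    exists ('D_(ebase i) f); first by apply: alg_base; left; exact: smooth_on_partial.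
    by move=> x Ux; exact: smooth_on_is_derive sf Ux.
  have [w1 sw1 dw] := sym_smooth_derive_cos sw.
  exists (fun x => w1 (acos (ray_ext q x)) * 'D_(ebase i) (ray_ext q) x).
    apply: alg_mul; apply: alg_base; first by right; exists w1.
    by left; exact: smooth_on_partial.
  move=> x Ux; apply: is_derive_of_line.
  (* The value 1 at the origin keeps [Q] inside the domain of [acos]. *)
  pose Q (s : R) := if x + s *: ebase i == 0 then 1 else ray_ext q (x + s *: ebase i).
  have QE : \forall s \near (0 : R), Q s = ray_ext q (x + s *: ebase i).
    have := near_line (ebase i) (@open_neq0 R n) Ux.
    by apply: filterS => s /= /negbTE s0; rewrite /Q s0.
  have Q0 : Q 0 = ray_ext q x by rewrite /Q scale0r addr0 (negbTE Ux).
  have bQ s : -1 <= Q s <= 1.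
    by rewrite /Q; case: eqVneq => [_|/ray_ext_itv//]; rewrite lexx andbT; lra.
  have dQ : is_derive (0 : R) 1 Q ('D_(ebase i) (ray_ext q) x).
    have U0 : U (x + (0 : R) *: ebase i) by rewrite scale0r addr0.
    apply: (@near_eq_is_derive _ _ _ (fun s : R => ray_ext q (x + s *: ebase i))).
      by apply: filterS QE => s ->.
    apply: is_derive_lineE; rewrite scale0r addr0.
    exact: smooth_on_is_derive sq Ux.
  have := is_derive_acos_comp dw (smooth1_cont sw1.1) bQ dQ.
  rewrite Q0; apply: near_eq_is_derive.
  by apply: filterS QE => s ->.
- move=> f [sf|[{sw}w sw ->]] x Ux; first exact: smooth_on_cont sf Ux.
  apply: (@continuous_comp _ _ _ (fun x => acos (ray_ext q x)) w).
    apply: acos_continuous_comp; first exact: smooth_on_cont sq Ux.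
    near=> y; apply: ray_ext_itv; near: y; exact: open_nbhs_nbhs (conj (@open_neq0 R n) Ux).
  exact: (smooth1_cont sw.1).
Unshelve. all: by end_near. Qed.

Variable g : R -> R.
Hypotheses (sg : smooth1 g) (g0 : forall t, 0 < g t).
Hypotheses (g_even : forall t, g (- t) = g t)
  (g_period : forall t, g (t + 2 * pi / d%:R) = g t).
Hypothesis g_convex : forall t,
  0 < 2 * g t * derive1n 2 g t - derive1 g t ^+ 2 + 4 * g t ^+ 2.

Lemma sym_smooth_sqrt_profile : sym_smooth (fun t => Num.sqrt (2 * g (d%:R^-1 * t))).
Proof.
split.
  apply: smooth1_sqrt; last by move=> t; rewrite mulr_gt0.
  by apply: smooth1_mul; [exact: smooth1_cst|exact: smooth1_scale].
pose G t := g (d%:R^-1 * t).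
suff H z : sin z = 0 -> forall t, G (2 * z - t) = G t.
  by move=> z /H h t; rewrite -/(G _) h.
have Gev t : G (- t) = G t by rewrite /G mulrN g_even.
have Gper t : G (t + 2 * pi) = G t.
  by rewrite /G mulrDr -[RHS]g_period; congr (g (_ + _)); rewrite mulrC.
have pos (N : nat) (x : R) : 0 <= x < N%:R * pi -> sin x = 0 -> forall t, G (2 * x - t) = G t.
  elim: N x => [|N IH] x /andP[x0 xN] sx t.
    by move: xN; rewrite mul0r ltNge x0.
  have [xpi|xpi] := ltP x pi.
    have -> : x = 0.
      apply/eqP; rewrite eq_le x0 andbT leNgt; apply/negP => x1.
      by have := sin_gt0_pi (introT andP (conj x1 xpi)); rewrite sx ltxx.
    by rewrite mulr0 sub0r Gev.
  have -> : 2 * x - t = 2 * (x - pi) - t + 2 * pi by ring.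
  rewrite Gper; apply: IH.
    by move: xN; rewrite -natr1 mulrDl mul1r => ?; apply/andP; split; lra.
  by rewrite sinB sinpi cospi mulr0 subr0 sx mul0r.
have archi (x : R) : 0 <= x -> exists N : nat, x < N%:R * pi.
  move=> x0; exists (Num.truncn (x / pi)).+1.
  rewrite -ltr_pdivrMr ?pi_gt0 //.
  by have /andP[_] := truncn_itv (divr_ge0 x0 (@pi_ge0 R)).
move=> sz t; have [z0|z0] := leP 0 z.
  by have [N zN] := archi z z0; apply: (pos N) => //; rewrite z0.
have zN0 : 0 <= - z by rewrite oppr_ge0 ltW.
have [N zN] := archi _ zN0.
have sz' : sin (- z) = 0 by rewrite sinN sz oppr0.
have h := pos N (- z) _ sz' (- t); rewrite zN0 zN in h.
rewrite -[RHS]Gev -h // -[LHS]Gev; congr G; ring.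
Qed.

Lemma profile_derive0 : derive1 g 0 = 0.
Proof.
have h t : g (2 * 0 - t) = g t by rewrite mulr0 sub0r.
by have := derive1_reflect sg h 0; rewrite mulr0 subr0; lra.
Qed.

Lemma profile_deriveT : derive1 g T = 0.
Proof.
have h t : g (2 * T - t) = g t.
  by rewrite -(g_even t) -[RHS]g_period addrC /T mulrA.
have := derive1_reflect sg h T.
have -> : 2 * T - T = T by ring.
lra.
Qed.

(** By compactness of the chamber the strict inequalities leave room for
   subtracting a small multiple of the Euclidean energy. *)
Lemma profile_gap : exists2 e, 0 < e & forall t, 0 <= t <= T ->
  0 < g t - e /\ 0 < 2 * (g t - e) * derive1n 2 g t - derive1 g t ^+ 2
    + 4 * (g t - e) ^+ 2.
Proof.
have T0 : 0 <= T by rewrite divr_ge0 // pi_ge0.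
have sg1 := smooth1_derive sg; have sg2 := smooth1_derive sg1.
have c u : smooth1 u -> {within `[0, T], continuous u}.
  by move=> su; apply: continuous_subspaceT; exact: smooth1_cont.
have s2 : smooth1 (derive1n 2 g) by [].
pose fA t := 2 * g t * derive1n 2 g t + (- (derive1 g t ^+ 2) + 4 * g t ^+ 2).
pose fB t := 2 * derive1n 2 g t + 8 * g t.
have sA : smooth1 fA.
  apply/smooth1_algE; apply: alg_add; first by
    apply: alg_mul; [apply: alg_mul; [exact: alg_cst|exact: alg_base]|exact: alg_base].
  apply: alg_add; first by apply: alg_opp; apply: alg_exp; exact: alg_base.
  by apply: alg_mul; [exact: alg_cst|apply: alg_exp; exact: alg_base].
have sB : smooth1 fB.
  by apply: smooth1_add; apply: smooth1_mul => //; exact: smooth1_cst.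
have [a _ minA] := EVT_min T0 (c _ sA).
have [b _ minG] := EVT_min T0 (c _ sg).
have [k _ maxB] := EVT_max T0 (c _ sB).
pose A := fA a; pose B := fB k.
have A0 : 0 < A by rewrite /A /fA; have := g_convex a; rewrite addrA.
pose e := Num.min (g b) (A / (1 + `|B|)) / 2.
have B1 : 0 < 1 + `|B| by rewrite ltr_pwDl.
have m0 : 0 < Num.min (g b) (A / (1 + `|B|)) by rewrite lt_min g0 divr_gt0.
have e0 : 0 < e by rewrite divr_gt0.
have eg : e < g b.
  by apply: (@lt_le_trans _ _ (Num.min (g b) (A / (1 + `|B|)))); [rewrite /e; lra|rewrite ge_min lexx].
have eA : e * (1 + `|B|) < A.
  rewrite -ltr_pdivlMr //.
  apply: (@lt_le_trans _ _ (Num.min (g b) (A / (1 + `|B|)))); first by rewrite /e; lra.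
  by rewrite ge_min lexx orbT.
exists e => // t ht; have ti : t \in `[0, T] by rewrite in_itv.
have h1 := minG t ti; have h2 := minA t ti; have h3 := maxB t ti.
split; first by rewrite subr_gt0; exact: lt_le_trans h1.
have h4 : e * fB t <= e * `|B|.
  by rewrite ler_pM2l // (le_trans h3) // ler_norm.
rewrite mulrDr mulr1 in eA.
have -> : 2 * (g t - e) * derive1n 2 g t - derive1 g t ^+ 2 + 4 * (g t - e) ^+ 2
  = fA t - e * fB t + 4 * e ^+ 2 by rewrite /fA /fB; ring.
have e2 : 0 < e ^+ 2 by rewrite exprn_gt0.
rewrite -/A in h2; lra.
Qed.

Let prof x := g (theta ((enorm x)^-1 *: x)).

(** The supporting hyperplanes of the norm with the smaller profile [g - e]
   bound the energy from below by [e |x|^2 + <x, z>^2 / 2], with equality at the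
   given point. *)
Lemma energy_lower_bound : exists2 e, 0 < e & forall x, x != 0 ->
  exists z, [/\ 0 < dotv x z,
    enorm x ^+ 2 * prof x = e * dotv x x + dotv x z ^+ 2 / 2 &
    forall y, y != 0 -> 0 <= dotv y z ->
      e * dotv y y + dotv y z ^+ 2 / 2 <= enorm y ^+ 2 * prof y].
Proof.
have d0' : 0 < d%:R :> R by rewrite ltr0n.
have T0 : 0 < T by rewrite divr_gt0 // pi_gt0.
have Tpi : T <= pi.
  by rewrite /T ler_pdivrMr // ler_peMr ?pi_ge0 // ler1n.
have [e e0 gap] := profile_gap; exists e => // x x0.
pose G t := Num.sqrt (2 * (g t - e)).
pose G1 t := derive1 g t / G t.
pose G2 t := (derive1n 2 g t - G1 t ^+ 2) / G t.
have Gp (t : R) : 0 <= t <= T -> 0 < G t.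
  by move=> /gap[h _]; rewrite sqrtr_gt0 mulr_gt0.
have Gsq (t : R) : 0 <= t <= T -> G t ^+ 2 = 2 * (g t - e).
  by move=> /gap[h _]; rewrite sqr_sqrtr // mulr_ge0 // ltW.
have dG (t : R) : 0 <= t <= T -> is_derive t 1 G (G1 t).
  move=> ht; have h : 0 < 2 * (g t - e) by rewrite mulr_gt0 //; have [] := gap t ht.
  have dh := is_derive_mul (is_derive_cstf t 1 2)
    (is_derive_sub (smooth1_is_derive t sg) (is_derive_cstf t 1 e)).
  apply: is_derive_eq (is_derive_sqrt_comp (f := fun t => 2 * (g t - e)) h dh) _.
  rewrite -/(G t) /G1; field; rewrite gt_eqF //; exact: Gp.
have dG1 (t : R) : 0 <= t <= T -> is_derive t 1 G1 (G2 t).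
  move=> ht; have h := lt0r_neq0 (Gp t ht).
  apply: is_derive_eq (is_derive_mul (smooth1_is_derive t (smooth1_derive sg))
    (is_derive_inv h (dG t ht))) _.
  rewrite /G2 -[derive1n 2 g t]/(derive1 (derive1 g) t) /G1; field; exact: h.
have conv (t : R) : 0 <= t <= T -> 0 < G2 t + G t.
  move=> ht; have h := Gp t ht.
  have [_ hc] := gap t ht.
  have -> : G2 t + G t = (G t ^+ 2 * derive1n 2 g t - derive1 g t ^+ 2
     + (G t ^+ 2) ^+ 2) / G t ^+ 3.
    by rewrite /G2 /G1; field; rewrite gt_eqF.
  rewrite divr_gt0 ?exprn_gt0 // Gsq //.
  by move: hc; rewrite exprMn; lra.
have G10 : G1 0 = 0 by rewrite /G1 profile_derive0 mul0r.
have G1T : G1 T = 0 by rewrite /G1 profile_deriveT mul0r.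
have hT x' : x' != 0 -> 0 <= theta ((enorm x')^-1 *: x') <= T.
  by move=> x'0; apply: (angle_itv angle); exact: sphere_normalize.
have [z xz yz] := support_hyperplane Tpi dG dG1 conv Gp G10 G1T angle erefl x0.
exists z; split.
- by rewrite xz mulr_gt0 ?enorm_gt0 // Gp // hT.
- by rewrite xz exprMn Gsq ?hT // -sqr_enorm /prof; field.
move=> y y0 hy.
have := yz y y0; set u := theta _ => h.
have : dotv y z ^+ 2 <= enorm y ^+ 2 * (2 * (g u - e)).
  by rewrite -Gsq ?hT // -exprMn ler_pXn2r ?nnegrE // mulr_ge0 ?enorm_ge0 ?sqrtr_ge0.
by rewrite /prof -/u -sqr_enorm; lra.
Qed.

Variable F : 'rV[R]_n -> R.
Hypothesis F0 : F 0 = 0.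
Hypothesis FE : forall x, x != 0 -> F x = enorm x * Num.sqrt (2 * prof x).

Lemma smooth_on_profile_norm : smooth_on U F.
Proof.
pose h t := Num.sqrt (2 * g (d%:R^-1 * t)).
apply: (@smooth_on_eq _ _ _ (fun x => enorm x * h (acos (ray_ext q x)))).
- exact: open_neq0.
- move=> x x0; rewrite FE // /prof (angle_acos (sphere_normalize x0)) //.
apply: smooth_on_algE; first exact: open_neq0.
apply: alg_mul; apply: alg_base; first exact: smooth_on_enorm.
exact: (smooth_on_profile sym_smooth_sqrt_profile).
Qed.

Lemma energy_profile x : x != 0 -> F x ^+ 2 / 2 = enorm x ^+ 2 * prof x.
Proof.
move=> x0; rewrite FE // exprMn [X in _ * X / _]sqr_sqrtr; first by field.
by rewrite mulr_ge0 // ltW // g0.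
Qed.

Lemma second_derivative_quadratic (a b c : R) :
  second_derivative (fun s => a + b * s + c * s ^+ 2) (2 * c).
Proof.
exists (fun s => b + 2 * c * s).
  near=> s.
  apply: is_derive_eq (is_derive_add (is_derive_add (is_derive_cstf s 1 a)
    (is_derive_mulc b s)) (is_derive_mul (is_derive_cstf s 1 c)
    (is_derive_exp 2 (is_derive_id s 1)))) _.
  by rewrite /= expr1; ring.
have := is_derive_add (is_derive_cstf (0 : R) 1 b) (is_derive_mulc (2 * c) 0).
by rewrite add0r.
Unshelve. all: by end_near. Qed.

(** Second-order comparison with the lower bound at the point where it is
   attained. *)
Lemma posdef_profile_norm x : x != 0 -> posdefmx (hessian (fun y => F y ^+ 2 / 2) x).
Proof.
move=> x0 v v0; have [e e0 /(_ x x0)[z [xz Ex Ey]]] := energy_lower_bound.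
have sE : smooth_on U (fun y => F y ^+ 2 / 2).
  apply: smooth_on_algE; first exact: open_neq0.
  apply: alg_mul; last exact: alg_cst.
  by apply: alg_exp; apply: alg_base; exact: smooth_on_profile_norm.
have D1 := second_derivative_line v (@open_neq0 R n) sE x0.
pose A := e * dotv x x + dotv x z ^+ 2 / 2.
pose B := 2 * e * dotv x v + dotv x z * dotv v z.
pose C := e * dotv v v + dotv v z ^+ 2 / 2.
have quad s : A + B * s + C * s ^+ 2 =
    e * dotv (x + s *: v) (x + s *: v) + dotv (x + s *: v) z ^+ 2 / 2.
  by rewrite !(dotvDl, dotvDr, dotvZl, dotvZr) (dotvC v x) /A /B /C; field.
have := second_derivative_min (second_derivative_sub D1 (second_derivative_quadratic A B C)).
have C0 : 0 < C.
  by rewrite ltr_wpDr ?divr_ge0 ?sqr_ge0 // mulr_gt0 // dotv_gt0.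
set hes := (_ *m _) 0 0 => H.
suff : 0 <= hes - 2 * C by move=> h; apply: lt_le_trans (_ : 0 < 2 * C) _; [rewrite mulr_gt0|rewrite -subr_ge0].
apply: H.
  rewrite quad scale0r addr0 energy_profile // Ex; ring.
have cont : dotv (x + s *: v) z @[s --> (0 : R)] --> dotv x z.
  have : {for (0 : R), continuous (fun s : R => dotv x z + dotv v z * s)}.
    have := is_derive_add (is_derive_cstf (0 : R) 1 (dotv x z)) (is_derive_mulc (dotv v z) 0).
    exact: is_derive_cont.
  rewrite /prop_for /continuous_at mulr0 addr0; apply: cvg_trans.
  by apply: near_eq_cvg; near=> s; rewrite dotvDl dotvZl mulrC.
have npos : \forall s \near (0 : R), 0 <= dotv (x + s *: v) z.
  move/cvgrPdist_lt: cont => /(_ _ xz); apply: filterS => s.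
  by rewrite ltr_norml => /andP[]; lra.
near=> s.
have ys : x + s *: v != 0 by near: s; exact: (near_line v (@open_neq0 R n) x0).
rewrite subr_ge0 quad energy_profile //; apply: Ey => //.
by near: s.
Unshelve. all: by end_near. Qed.

(** The profile is bounded on the chamber, so [F] is bounded by a multiple of the
   Euclidean norm. *)
Lemma continuous0_profile_norm : {for (0 : 'rV[R]_n), continuous F}.
Proof.
have T0 : 0 <= T by rewrite divr_ge0 // pi_ge0.
have [k _ maxg] := EVT_max T0 (continuous_subspaceT (smooth1_cont sg)).
pose K := Num.sqrt (2 * g k).
have K0 : 0 <= K by exact: sqrtr_ge0.
have FK x : 0 <= F x <= K * enorm x.
  have [->|x0] := eqVneq x 0; first by rewrite F0 enorm0 mulr0 lexx.
  rewrite FE // mulr_ge0 ?enorm_ge0 ?sqrtr_ge0 //= mulrC ler_wpM2r ?enorm_ge0 //.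
  rewrite ler_wsqrtr // ler_pM2l //; apply: maxg; rewrite in_itv.
  by apply: (angle_itv angle); exact: sphere_normalize.
rewrite /prop_for /continuous_at F0.
have c : K * enorm x @[x --> (0 : 'rV[R]_n)] --> (0 : R).
  have -> : 0 = K * enorm (0 : 'rV[R]_n) by rewrite enorm0 mulr0.
  by apply: (@cvgM _ _ (nbhs (0 : 'rV[R]_n))); [exact: cvg_cst|exact: continuous_enorm].
have nFK : \forall x \near (0 : 'rV[R]_n), 0 <= F x <= K * enorm x.
  by near=> x; exact: FK.
apply: (@squeeze_cvgr _ _ _ R (fun=> 0) (fun x => K * enorm x) F nFK 0) => //.
exact: cvg_cst.
Unshelve. all: by end_near. Qed.

Theorem minkowski_of_profile : minkowski_norm F.
Proof.
have Fp x : x != 0 -> 0 < F x.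
  by move=> x0; rewrite FE // mulr_gt0 ?enorm_gt0 // sqrtr_gt0 mulr_gt0 // g0.
split => //.
- split => x; have [->|x0] := eqVneq x 0.
  + exact: continuous0_profile_norm.
  + exact: smooth_on_cont smooth_on_profile_norm x0.
  + by rewrite F0.
  + by rewrite ltW // Fp.
- exact: smooth_on_profile_norm.
- move=> l x; rewrite le_eqVlt => /orP[/eqP <-|l0]; first by rewrite scale0r mul0r.
  have [->|x0] := eqVneq x 0; first by rewrite scaler0 F0 mulr0.
  have lx : l *: x != 0 by rewrite scaler_eq0 negb_or x0 gt_eqF.
  rewrite !FE // enormZ gtr0_norm // -mulrA /prof; congr (_ * (_ * Num.sqrt (2 * g (theta _)))).
  by rewrite enormZ gtr0_norm // invfM scalerA mulrAC mulVf ?gt_eqF // mul1r.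
- by move=> x x0; exact: posdef_profile_norm.
Qed.

End ProfileToNorm.

(** * From Minkowski norms to profiles *)

Section PolarCoordinates.
Variable R : realType.

Lemma polar_coordinates (x : 'rV[R]_2) :
  exists r t, 0 <= r /\ x = vec2 (r * cos t) (r * sin t).
Proof.
have xE : x = vec2 (x 0 0) (x 0 1).
  apply/rowP => i; rewrite mxE; have [->|->] : i = 0 \/ i = 1 => //.
  by case: i => [[|[|//]] hi]; [left|right]; exact: val_inj.
move: xE; set a := x 0 0; set b := x 0 1 => ->.
pose r := Num.sqrt (a ^+ 2 + b ^+ 2).
have ab0 : 0 <= a ^+ 2 + b ^+ 2 by rewrite addr_ge0 // sqr_ge0.
have r2 : r ^+ 2 = a ^+ 2 + b ^+ 2 by rewrite sqr_sqrtr.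
have r0 : 0 <= r by exact: sqrtr_ge0.
have [rz|rn] := eqVneq r 0.
  exists 0, 0; split=> //; rewrite !mul0r.
  move: r2; rewrite rz expr0n /= => /esym/eqP.
  by rewrite paddr_eq0 ?sqr_ge0 // !sqrf_eq0 => /andP[/eqP -> /eqP ->].
have rp : 0 < r by rewrite lt_def rn.
have hab : (a / r) ^+ 2 + (b / r) ^+ 2 = 1.
  by rewrite !expr_div_n -mulrDl -r2 divff // expf_neq0.
have ha : -1 <= a / r <= 1.
  rewrite -ler_norml -(@ler_pXn2r _ 2) ?nnegrE // expr1n real_normK ?num_real //.
  by rewrite -hab lerDl sqr_ge0.
have ca : cos (acos (a / r)) = a / r by rewrite acosK // in_itv.
have sa : sin (acos (a / r)) = `|b / r|.
  by rewrite sin_acos // -hab addrAC subrr add0r sqrtr_sqr.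
have [b0|b0] := leP 0 b.
  exists r, (acos (a / r)); split => //; rewrite ca sa ger0_norm ?divr_ge0 //.
  by rewrite ![r * _]mulrC !divfK.
exists r, (- acos (a / r)); split => //; rewrite cosN sinN ca sa ler0_norm ?opprK.
  by rewrite ![r * _]mulrC !divfK.
by rewrite pmulr_lle0 ?invr_gt0 // ltW.
Qed.

Lemma refl2_polar (r t : R) :
  refl2 (vec2 (r * cos t) (r * sin t)) = vec2 (r * cos (- t)) (r * sin (- t)).
Proof. by rewrite /refl2 !mxE /= cosN sinN mulrN. Qed.

Lemma rot2_polar (a r t : R) :
  rot2 a (vec2 (r * cos t) (r * sin t)) = vec2 (r * cos (t + a)) (r * sin (t + a)).
Proof.
by rewrite /rot2 !mxE /= cosD sinD; congr vec2; ring.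
Qed.

Lemma cisE (t : R) : cis t = vec2 (1 * cos t) (1 * sin t).
Proof. by rewrite !mul1r. Qed.

(** Positivity of [g] follows from that of [N], as the square root of a
   nonpositive number is 0; hence [g] is the energy of [N] on the unit circle. *)
Lemma profile_of_planar_norm (d : nat) (g : R -> R) (N : 'rV[R]_2 -> R) :
  polar_presentation g N -> dihedral_invariant d N -> minkowski_norm N ->
  [/\ dihedral_angle_invariant d g, forall t, 0 < g t, smooth1 g &
    forall t, 0 < 2 * g t * derive1n 2 g t - derive1 g t ^+ 2 + 4 * g t ^+ 2].
Proof.
move=> polar inv NM; have [_ Np _ _ _] := NM.
have Ncis t : N (cis t) = Num.sqrt (2 * g t) by rewrite cisE polar // mul1r.
have g0 t : 0 < g t.
  by have := Np _ (cis_neq0 t); rewrite Ncis sqrtr_gt0 pmulr_rgt0.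
have gE : g = (fun t => N (cis t) ^+ 2 / 2).
  apply/funext => t; rewrite Ncis sqr_sqrtr; first by field.
  by rewrite mulr_ge0 // ltW.
have dinv : dihedral_angle_invariant d g.
  move=> h; elim=> [//|t|t|h1 h2 _ IH1 _ IH2 t]; last by rewrite /= IH1 IH2.
  - by rewrite gE !cisE -refl2_polar (inv _ (dihedral_refl R d)).
  - by rewrite gE !cisE -rot2_polar (inv _ (dihedral_rot R d)).
have [sN pN iN] := planar_minkowski_ineq NM.
by rewrite gE in dinv *; split.
Qed.

End PolarCoordinates.

Section NormalPlane.
Variables (R : realType) (n d : nat) (q theta : 'rV[R]_n -> R).
Hypothesis d0 : (0 < d)%N.
Hypothesis angle : isoparametric_angle d q theta.
Variables (y v : 'rV[R]_n).
Hypotheses (sy : sphere y) (sv : sphere v) (yv : dotv y v = 0).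
(* On this great circle the angle is the distance of [t] to the multiples of
   [2 pi / d]. *)
Hypothesis circle_cos : forall t, q (great_circle y v t) = cos (d%:R * t).
Variables (f : R -> R) (F : 'rV[R]_n -> R).
Hypothesis FE : forall x, sphere x -> F x = Num.sqrt (2 * f (theta x)).
Hypothesis FM : minkowski_norm F.

Lemma circle_norm_eq s t : cos (d%:R * s) = cos (d%:R * t) ->
  F (great_circle y v s) = F (great_circle y v t).
Proof.
move=> st; have sc u : sphere (great_circle y v u) by exact: sphere_circle.
by rewrite !FE // !(angle_acos d0 angle) // !circle_cos st.
Qed.

Lemma plane_map_polar r t : 0 <= r ->
  F (plane_map y v (vec2 (r * cos t) (r * sin t))) = r * F (great_circle y v t).
Proof.
move=> r0; have [_ _ _ <- // _] := FM; congr F.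
by rewrite /plane_map /great_circle !mxE /= scalerDr !scalerA.
Qed.

Lemma plane_map_dihedral : dihedral_invariant d (F \o plane_map y v).
Proof.
have d0' : d%:R != 0 :> R by rewrite pnatr_eq0 -lt0n.
move=> h; elim=> [//|x|x|h1 h2 _ IH1 _ IH2 x].
- have [r [t [r0 ->]]] := polar_coordinates x.
  rewrite refl2_polar /= !plane_map_polar //; congr (_ * _); apply: circle_norm_eq.
  by rewrite mulrN cosN.
- have [r [t [r0 ->]]] := polar_coordinates x.
  rewrite rot2_polar /= !plane_map_polar //; congr (_ * _); apply: circle_norm_eq.
  have -> : d%:R * (t + 2 * pi / d%:R) = d%:R * t + pi *+ 2 by rewrite -mulr_natl; field.
  exact: cosD2pi.
- by have := IH1 (h2 x); have := IH2 x => /= -> ->.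
Qed.

Lemma circle_profile_polar :
  polar_presentation (fun t => F (great_circle y v t) ^+ 2 / 2) (F \o plane_map y v).
Proof.
move=> r t r0; rewrite /= plane_map_polar //; congr (_ * _).
rewrite mulrCA divff ?pnatr_eq0 // mulr1 sqrtr_sqr ger0_norm //.
by have [[_ +] _ _ _ _] := FM.
Qed.

Lemma circle_profile_periodic : circle_fun (fun t => F (great_circle y v t) ^+ 2 / 2).
Proof.
move=> t; congr (F _ ^+ 2 / 2); rewrite /great_circle.
by rewrite mulr_natl cosD2pi sinD2pi.
Qed.

End NormalPlane.

Unset Implicit Arguments.
Set Strict Implicit.
Set Printing Implicit Defensive.

Theorem theoremA (R : realType) (n d : nat) (M : R -> set 'rV[R]_n)
    (f : R -> R) (F : 'rV[R]_n -> R)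
    (hn : (2 < n)%N)
    (hM : isoparametric_foliation d M)
    (hf : forall t, 0 <= t <= pi / d%:R -> 0 < f t)
    (hF : foliation_radial d M f F) :
  [/\ minkowski_norm F <-> induced_minkowski_norm d M F,
      minkowski_norm F <->
        (exists g : R -> R,
          [/\ extends_on d f g,
              circle_fun g /\ dihedral_angle_invariant d g,
              (forall t, 0 < g t),
              smooth1 g &
              forall t, 0 < 2 * g t * derive1n 2 g t - derive1 g t ^+ 2 + 4 * g t ^+ 2]) &
      minkowski_norm F <->
        (exists (g : R -> R) (Fbar : 'rV[R]_2 -> R),
          [/\ extends_on d f g,
              circle_fun g,
              polar_presentation g Fbar,
              dihedral_invariant d Fbar &
              minkowski_norm Fbar])].
Proof.
have n1 : (1 < n)%N by exact: ltnW.
have d0 := foliation_deg hM.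
have [_ [[leafE leaf _] _]] := foliation_leaf hM.
have [q angle [y [v [sy sv yv qc thc]]]] := foliation_angle n1 hM.
set theta := fun x => sdist x (M 0) in leafE leaf angle thc.
have [F0 FE] := hF.
have FleafE t x : 0 <= t <= pi / d%:R -> M t x -> F x = Num.sqrt (2 * f t).
  move=> ht Mx; have [sx _] := leafE t x ht Mx.
  by rewrite (FE x t) ?sx ?invr1 ?scale1r ?mul1r // sphere_neq0.
have FthE x : sphere x -> F x = Num.sqrt (2 * f (theta x)).
  by move=> sx; have [ht Mx] := leaf x sx; exact: FleafE.
have to_planar : minkowski_norm F -> exists g Fbar, [/\ extends_on d f g,
    circle_fun g, polar_presentation g Fbar, dihedral_invariant d Fbar &
    minkowski_norm Fbar].
  move=> FM; exists (fun t => F (great_circle y v t) ^+ 2 / 2), (F \o plane_map y v); split.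
  - move=> t ht; rewrite FthE; last exact: sphere_circle.
    rewrite /theta thc // sqr_sqrtr; first by field.
    by rewrite mulr_ge0 // ltW // hf.
  - exact: circle_profile_periodic.
  - exact: circle_profile_polar.
  - exact: plane_map_dihedral d0 angle _ _ sy sv yv qc _ _ FthE FM.
  - by apply: minkowski_norm_plane => //; exact: sphere_dotv.
have to_profile : (exists g Fbar, [/\ extends_on d f g,
    circle_fun g, polar_presentation g Fbar, dihedral_invariant d Fbar &
    minkowski_norm Fbar]) -> exists g : R -> R,
          [/\ extends_on d f g,
              circle_fun g /\ dihedral_angle_invariant d g,
              (forall t, 0 < g t),
              smooth1 g &
              forall t, 0 < 2 * g t * derive1n 2 g t - derive1 g t ^+ 2 + 4 * g t ^+ 2].
  move=> [g [N [gf gc polar inv NM]]]; exists g.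
  by have [? ? ? ?] := profile_of_planar_norm polar inv NM.
have to_norm : (exists g : R -> R,
          [/\ extends_on d f g,
              circle_fun g /\ dihedral_angle_invariant d g,
              (forall t, 0 < g t),
              smooth1 g &
              forall t, 0 < 2 * g t * derive1n 2 g t - derive1 g t ^+ 2 + 4 * g t ^+ 2]) ->
    minkowski_norm F.
  move=> [g [gf [_ inv] g0 sg gconv]].
  apply: (minkowski_of_profile d0 angle sg g0 _ _ gconv F0).
  - by move=> t; exact: (inv _ (dihedral_angle_opp R d)).
  - by move=> t; exact: (inv _ (dihedral_angle_shift R d)).
  - move=> x x0; have [ht Mx] := leaf _ (sphere_normalize x0).
    by rewrite (FE x _ x0 ht Mx) gf.
split; split.
- move=> FM; split => // t ht x z Mx Mz; by rewrite !(FleafE t).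
- by case.
- by move=> /to_planar/to_profile.
- exact: to_norm.
- exact: to_planar.
- by move=> /to_profile/to_norm.
Qed.
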